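(* Let $M$ be a connected topological manifold of dimension at least $2$ with an effective action of a finite group $G$, let $n\ge 2$, and let ${\bf x}\in F_G(M,n)$ be a base point all of whose coordinates have orbits of free type. Then there is an epimorphism between two short exact sequences, induced by the embedding $F_G(M,n)\hookrightarrow F(M,n)$: a commutative diagram with exact rows $$\begin{array}{ccccccccc}1&\to&\mathcal{P}_n(M,G)&\to&\mathcal{B}_n(M,G)&\to&\Sigma_n&\to&1\\&&\downarrow&&\downarrow&&\downarrow{=}&&\\1&\to&P_n(M)&\to&B_n(M)&\to&\Sigma_n&\to&1\end{array}$$ whose vertical homomorphisms $\mathcal{P}_n(M,G)\to P_n(M)$ and $\mathcal{B}_n(M,G)\to B_n(M)$ are surjective.
   Context: $F_G(M,n)=\{(y_1,\dots,y_n)\in M^{\times n}\mid G(y_i)\cap G(y_j)=\emptyset \text{ for } i\neq j\}$ and $F(M,n)=\{(y_1,\dots,y_n)\in M^{\times n}\mid y_i\neq y_j\text{ for }i\ne j\}$. $P_n(M)=\pi_1(F(M,n))$, $B_n(M)=\pi_1(F(M,n)/\Sigma_n)$ (base points given by ${\bf x}$). For an $n$-tuple $y$ (of points, paths or group elements) and $\sigma\in\Sigma_n$ put $y_\sigma=(y_{\sigma(1)},\dots,y_{\sigma(n)})$; products in $\Sigma_n$ are taken so that $(\sigma\tau)(i)=\tau(\sigma(i))$. An orbit is of free type if isotropy groups of its points are trivial. Orbit braids: a path $\alpha:I\to F_G(M,n)$ with $\alpha(0)={\bf x}$ and $\alpha(1)=g{\bf x}_\sigma$, $(g,\sigma)\in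 G^{\times n}\times\Sigma_n$ (a unique pair), determines the orbit braid $\widetilde{c(\alpha)}=\{\widetilde{c(\alpha_1)},\dots,\widetilde{c(\alpha_n)}\}$ (unordered), where $\widetilde{c(\alpha_i)}$ is the collection of the strings $\{(h\alpha_i(s),s)\mid s\in I\}\subset M\times I$, $h\in G$. Orbit braids $\widetilde{c(\alpha)},\widetilde{c(\beta)}$ are equivalent if there are paths $\alpha',\beta'$ in $F_G(M,n)$ with $\widetilde{c(\alpha')}=\widetilde{c(\alpha)}$, $\widetilde{c(\beta')}=\widetilde{c(\beta)}$ and $\alpha'\simeq\beta'$ rel $\partial I$. The orbit braid group $\mathcal{B}_n^{orb}(M,G)$ is the group of equivalence classes with product $[\widetilde{c(\alpha)}]*[\widetilde{c(\beta)}]=[\widetilde{c(\alpha\circ(g\beta_\sigma))}]$, where $\alpha(0)=\beta(0)={\bf x}$, $\alpha(1)=g{\bf x}_\sigma$ and $\circ$ is concatenation. $\mathcal{B}_n(M,G)$ and $\mathcal{P}_n(M,G)$ are the subgroups of classes with $\alpha(0)={\bf x}$ and, respectively, $\alpha(1)\in\{{\bf x}_\sigma\mid\sigma\in\Sigma_n\}$ and $\alpha(1)={\bf x}$. The map $\mathcal{B}_n(M,G)\to\Sigma_n$ sends $[\widetilde{c(\alpha)}]$ with $\alpha(1)={\bf x}_\sigma$ to $\sigma$; the map $B_n(M)\to\Sigma_n$ is the corresponding map for the covering $F(M,n)\to F(M,n)/\Sigma_n$ (lift a loop to start at ${\bf x}$; if it ends at ${\bf x}_\sigma$ take $\sigma$).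 *)

(* Defs.v *)
From HB Require Import structures.
From mathcomp Require Import all_boot all_order all_algebra all_fingroup.
From mathcomp Require Import generic_quotient ring lra.
From mathcomp Require Import all_classical reals topology normedtype homotopy.

Set Implicit Arguments.
Unset Strict Implicit.
Unset Printing Implicit Defensive.

Import Order.TTheory GRing.Theory Num.Theory.
Import numFieldNormedType.Exports.

Local Open Scope classical_set_scope.
Local Open Scope ring_scope.

Lemma continuous_if {R : realType} {X Y : topologicalType} (a : X -> R)
    (f g : X -> Y) : continuous a -> continuous f -> continuous g ->
  (forall x, a x = 0 -> f x = g x) ->
  continuous (fun x => if a x <= 0 then f x else g x).
Proof.
move=> ca cf cg fg x U /=.
suff: nbhs (if a x <= 0 then f x else g x) U ->
  \forall y \near x, U (if a y <= 0 then f y else g y) by [].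
have [a0|a0|a0] := ltgtP (a x) 0 => nU.
- have nf : \forall y \near x, U (f y) by exact: cf nU.
  have na : \forall y \near x, a y < 0 by apply: (cvgr_lt (a x) (ca x) 0 a0).
  near=> y; rewrite ifT; first by near: y.
  by apply: ltW; near: y.
- have ng : \forall y \near x, U (g y) by exact: cg nU.
  have na : \forall y \near x, 0 < a y by apply: (cvgr_gt (a x) (ca x) 0 a0).
  near=> y; rewrite ifF; first by near: y.
  by apply/negbTE; rewrite -ltNge; near: y.
- have nf : \forall y \near x, U (f y) by exact: cf nU.
  have ng : \forall y \near x, U (g y) by apply: cg; rewrite -fg.
  by near=> y; case: ifP => _; near: y.
Unshelve. all: by end_near. Qed.

Lemma continuous_initial {S : choiceType} {T X : topologicalType} (f : S -> T)
    (g : X -> initial_topology f) :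
  continuous (f \o g : X -> T) -> continuous g.
Proof.
move=> /continuousP cfg; apply/continuousP => _ [A oA <-].
exact: (cfg A oA).
Qed.

Lemma continuous_ptws {I : Type} {X T : topologicalType}
    (g : X -> {ptws I -> T}) :
  (forall i, continuous (fun x => g x i)) -> continuous g.
Proof.
move=> cg x; apply/cvg_sup => i; apply: (@continuous_initial _ _ _ _ _) => y.
exact: cg.
Qed.

Lemma continuous_ptws_proj {I : eqType} {T : topologicalType} (i : I) :
  continuous (fun y : {ptws I -> T} => y i).
Proof. exact: (@proj_continuous I (fun=> T) i). Qed.

Section unit_interval.
Variable R : realType.

Definition unit_interval : Type := set_type `[0%R : R, 1%R]%classic.

HB.instance Definition _ := Topological.on unit_interval.

Fact clamp_subproof (t : R) :
  Num.max 0 (Num.min t 1) \in `[0%R : R, 1%R]%classic.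
Proof. by rewrite inE /= in_itv /= le_max lexx ge_max ler01 ge_min lexx orbT. Qed.

Definition clamp (t : R) : unit_interval := 
  @exist R (fun t => t \in `[0%R : R, 1%R]%classic) _ (clamp_subproof t).

Definition ival (s : unit_interval) : R := set_val s.

Lemma ival_itv s : 0 <= ival s <= 1.
Proof. by case: s => s p; have := p; rewrite inE /= in_itv. Qed.

Lemma ival_ge0 s : 0 <= ival s. Proof. by case/andP: (ival_itv s). Qed.
Lemma ival_le1 s : ival s <= 1. Proof. by case/andP: (ival_itv s). Qed.

Lemma ival_inj : injective ival. Proof. exact: val_inj. Qed.

Lemma clampE t : ival (clamp t) = Num.max 0 (Num.min t 1). Proof. by []. Qed.

Lemma ivalK : cancel ival clamp.
Proof.
move=> s; apply: ival_inj; rewrite clampE.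
by case/andP: (ival_itv s) => s0 s1; rewrite min_l // max_r.
Qed.

Lemma clampK t : 0 <= t <= 1 -> ival (clamp t) = t.
Proof. by case/andP => s0 s1; rewrite clampE min_l // max_r. Qed.

Lemma ival_continuous : continuous ival.
Proof. exact: initial_continuous. Qed.

Lemma continuous_to_interval {X : topologicalType} (f : X -> unit_interval) :
  continuous (ival \o f) -> continuous f.
Proof. exact: continuous_initial. Qed.

Lemma clamp_continuous : continuous clamp.
Proof.
apply: continuous_to_interval => t /=.
have c : {for t, continuous
    ((fun=> 0 : R^o) \max ((id : R -> R^o) \min (fun=> 1 : R^o)))}.
  apply: continuous_max; first exact: cst_continuous.
  by apply: continuous_min; [exact: cvg_id|exact: cst_continuous].
exact: c.
Qed.

Fact zero_one_subproof : clamp 0 != clamp 1.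
Proof.
by apply/eqP => /(congr1 ival); rewrite !clampK ?lexx ?ler01 // => /eqP; rewrite eq_sym oner_eq0.
Qed.

HB.instance Definition _ :=
  @isBiPointed.Build unit_interval (clamp 0) (clamp 1) zero_one_subproof.

Lemma ival0 : ival zero = 0. Proof. by rewrite clampK // lexx ler01. Qed.
Lemma ival1 : ival one = 1. Proof. by rewrite clampK // lexx ler01. Qed.

End unit_interval.

Section homotopy.
Context {R : realType} {T : topologicalType}.
Local Notation I := (unit_interval R).
Implicit Types f g h : I -> T.

(* Homotopy relative to the endpoints; the first coordinate is the path
   parameter. *)
Definition homotopic_rel f g := exists H : I * I -> T,
  [/\ continuous H,
      forall s, H (s, zero) = f s,
      forall s, H (s, one) = g s,
      forall t, H (zero, t) = f zero &
      forall t, H (one, t) = f one].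

Definition concat f g (s : I) : T :=
  if 2 * ival s <= 1 then f (clamp (2 * ival s))
  else g (clamp (2 * ival s - 1)).

Definition path_rev f (s : I) : T := f (clamp (1 - ival s)).

Lemma concat0 f g : concat f g zero = f zero.
Proof. by rewrite /concat ival0 mulr0 ler01. Qed.

Lemma concat1 f g : concat f g one = g one.
Proof.
rewrite /concat ival1 mulr1 ifF; last by apply/negbTE; rewrite -ltNge; lra.
by congr g; apply: ival_inj; rewrite clampK ?ival1; lra.
Qed.

Lemma path_rev0 f : path_rev f zero = f one.
Proof. by rewrite /path_rev ival0 subr0. Qed.

Lemma path_rev1 f : path_rev f one = f zero.
Proof. by rewrite /path_rev ival1 subrr. Qed.

Lemma continuous_paste {X Y : topologicalType} (a b : X -> R) (f g : X -> Y) :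
  continuous a -> continuous b -> continuous f -> continuous g ->
  (forall x, a x = b x -> f x = g x) ->
  continuous (fun x => if a x <= b x then f x else g x).
Proof.
move=> ca cb cf cg fg.
rewrite (_ : (fun x => _) = fun x => if a x - b x <= 0 then f x else g x).
  apply: continuous_if => //; last by move=> x /eqP; rewrite subr_eq0 => /eqP/fg.
  by move=> x; apply: cvgB; [exact: ca|exact: cb].
by apply/funext => x; rewrite subr_le0.
Qed.


Lemma cts_comp {X Y Z : topologicalType} (f : X -> Y) (g : Y -> Z) :
  continuous f -> continuous g -> continuous (fun x => g (f x)).
Proof. by move=> cf cg x; apply: (@continuous_comp _ _ _ f g); [exact: cf|exact: cg]. Qed.

Lemma cts_pair {X Y Z : topologicalType} (f : X -> Y) (g : X -> Z) :
  continuous f -> continuous g -> continuous (fun x => (f x, g x)).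
Proof. by move=> cf cg x; apply: cvg_pair; [exact: cf|exact: cg]. Qed.

Lemma cts_fst {X Y : topologicalType} : continuous (fun p : X * Y => p.1).
Proof. by move=> x; exact: cvg_fst. Qed.

Lemma cts_snd {X Y : topologicalType} : continuous (fun p : X * Y => p.2).
Proof. by move=> x; exact: cvg_snd. Qed.

Lemma cts_clamp {X : topologicalType} (a : X -> R) :
  continuous a -> continuous (fun x => clamp (a x) : I).
Proof. by move=> ca; apply: cts_comp ca _; exact: clamp_continuous. Qed.

Lemma cts_ival {X : topologicalType} (a : X -> I) :
  continuous a -> continuous (fun x => ival (a x)).
Proof. by move=> ca; apply: cts_comp ca _; exact: ival_continuous. Qed.

Lemma ctsD {X : topologicalType} (a b : X -> R) :
  continuous a -> continuous b -> continuous (fun x => a x + b x).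
Proof. by move=> ca cb x; apply: cvgD; [exact: ca|exact: cb]. Qed.

Lemma ctsB {X : topologicalType} (a b : X -> R) :
  continuous a -> continuous b -> continuous (fun x => a x - b x).
Proof. by move=> ca cb x; apply: cvgB; [exact: ca|exact: cb]. Qed.

Lemma ctsM {X : topologicalType} (a b : X -> R) :
  continuous a -> continuous b -> continuous (fun x => a x * b x).
Proof. by move=> ca cb x; apply: cvgM; [exact: ca|exact: cb]. Qed.

Lemma cts_cst {X Y : topologicalType} (c : Y) : continuous (fun _ : X => c).
Proof. exact: cst_continuous. Qed.

Lemma cts_id {X : topologicalType} : continuous (fun x : X => x).
Proof. by move=> x; exact: cvg_id. Qed.

(* Pastes two maps along the parameter a, run at double speed. *)
Lemma cts_glue {X Y Z : topologicalType} (a : X -> I) (b : X -> Y)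
    (F G : I * Y -> Z) :
  continuous a -> continuous b -> continuous F -> continuous G ->
  (forall y, F (one, y) = G (zero, y)) ->
  continuous (fun x => if 2 * ival (a x) <= 1 then F (clamp (2 * ival (a x)), b x)
                       else G (clamp (2 * ival (a x) - 1), b x)).
Proof.
move=> ca cb cF cG FG.
have c2a : continuous (fun x => 2 * ival (a x)).
  by apply: ctsM; [exact: cts_cst|exact: cts_ival].
apply: continuous_paste => //.
- exact: cts_cst.
- by apply: cts_comp cF; apply: cts_pair cb; exact: cts_clamp.
- apply: cts_comp cG; apply: cts_pair cb; apply: cts_clamp.
  by apply: ctsB c2a _; exact: cts_cst.
- by move=> x ->; rewrite subrr; exact: FG.
Qed.

Lemma concat_continuous f g : continuous f -> continuous g -> f one = g zero ->
  continuous (concat f g).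
Proof.
move=> cf cg fg.
apply: (@cts_glue I I T id id (fun p => f p.1) (fun p => g p.1)).
- exact: cts_id.
- exact: cts_id.
- by apply: cts_comp cf; exact: cts_fst.
- by apply: cts_comp cg; exact: cts_fst.
- by [].
Qed.

Lemma path_rev_continuous f : continuous f -> continuous (path_rev f).
Proof.
move=> cf; apply: cts_comp cf; apply: cts_clamp; apply: ctsB.
  exact: cts_cst.
exact: cts_ival cts_id.
Qed.

Lemma homotopic_refl f : continuous f -> homotopic_rel f f.
Proof.
by move=> cf; exists (fun p => f p.1); split => //; apply: cts_comp cf; exact: cts_fst.
Qed.

Lemma homotopic_ends f g : homotopic_rel f g ->
  f zero = g zero /\ f one = g one.
Proof. by move=> [H [_ H0 H1 Hz Ho]]; rewrite -!H1 Hz Ho. Qed.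

Lemma homotopic_continuous f g : homotopic_rel f g ->
  continuous f /\ continuous g.
Proof.
move=> [H [cH H0 H1 _ _]]; split.
  rewrite (_ : f = fun s => H (s, zero)); last by apply/funext.
  by apply: cts_comp cH; apply: cts_pair; [exact: cts_id|exact: cts_cst].
rewrite (_ : g = fun s => H (s, one)); last by apply/funext.
by apply: cts_comp cH; apply: cts_pair; [exact: cts_id|exact: cts_cst].
Qed.

Lemma homotopic_sym f g : homotopic_rel f g -> homotopic_rel g f.
Proof.
move=> /[dup] /homotopic_ends [fg0 fg1] [H [cH H0 H1 Hz Ho]].
exists (fun p => H (p.1, clamp (1 - ival p.2))); split => /=.
- apply: cts_comp cH; apply: cts_pair; first exact: cts_fst.
  by apply: cts_clamp; apply: ctsB; [exact: cts_cst|exact: cts_ival cts_snd].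
- by move=> s; rewrite ival0 subr0.
- by move=> s; rewrite ival1 subrr.
- by move=> t; rewrite Hz.
- by move=> t; rewrite Ho.
Qed.

Lemma homotopic_trans f g h : homotopic_rel f g -> homotopic_rel g h ->
  homotopic_rel f h.
Proof.
move=> /[dup] /homotopic_ends [fg0 fg1] [H [cH H0 H1 Hz Ho]] [K [cK K0 K1 Kz Ko]].
exists (fun p => concat (fun t => H (p.1, t)) (fun t => K (p.1, t)) p.2); split.
- apply: (@cts_glue _ I T (fun p => p.2) (fun p => p.1)
    (fun q => H (q.2, q.1)) (fun q => K (q.2, q.1))).
  + exact: cts_snd.
  + exact: cts_fst.
  + by apply: cts_comp cH; apply: cts_pair; [exact: cts_snd|exact: cts_fst].
  + by apply: cts_comp cK; apply: cts_pair; [exact: cts_snd|exact: cts_fst].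
  + by move=> s /=; rewrite H1 K0.
- by move=> s; rewrite concat0.
- by move=> s; rewrite concat1.
- by move=> t /=; rewrite /concat; case: ifP => _; rewrite ?Hz // Kz.
- by move=> t /=; rewrite /concat; case: ifP => _; rewrite ?Ho // Ko.
Qed.

Lemma homotopic_concat f f' g g' : f one = g zero ->
  homotopic_rel f f' -> homotopic_rel g g' ->
  homotopic_rel (concat f g) (concat f' g').
Proof.
move=> fg [H [cH H0 H1 Hz Ho]] [K [cK K0 K1 Kz Ko]].
exists (fun p => concat (fun s => H (s, p.2)) (fun s => K (s, p.2)) p.1); split.
- apply: (@cts_glue _ I T (fun p => p.1) (fun p => p.2) H K) => //.
  + exact: cts_fst.
  + exact: cts_snd.
  + by move=> s /=; rewrite Ho Kz.
- by move=> s; rewrite /concat /=; case: ifP.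
- by move=> s; rewrite /concat /=; case: ifP.
- by move=> t /=; rewrite !concat0.
- by move=> t /=; rewrite !concat1.
Qed.

(* Two reparametrizations of a path with the same endpoints are homotopic. *)
Lemma homotopic_reparam f (a b : I -> I) :
  continuous f -> continuous a -> continuous b ->
  a zero = b zero -> a one = b one ->
  homotopic_rel (fun s => f (a s)) (fun s => f (b s)).
Proof.
move=> cf ca cb ab0 ab1.
exists (fun p => f (clamp ((1 - ival p.2) * ival (a p.1)
                           + ival p.2 * ival (b p.1)))); split => /=.
- apply: cts_comp cf; apply: cts_clamp; apply: ctsD; apply: ctsM.
  + by apply: ctsB; [exact: cts_cst|exact: cts_ival cts_snd].
  + by apply: cts_ival; apply: cts_comp ca; exact: cts_fst.
  + exact: cts_ival cts_snd.
  + by apply: cts_ival; apply: cts_comp cb; exact: cts_fst.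
- by move=> s; rewrite ival0 subr0 mul1r mul0r addr0 ivalK.
- by move=> s; rewrite ival1 subrr mul1r mul0r add0r ivalK.
- by move=> t; rewrite ab0 -mulrDl subrK mul1r ivalK.
- by move=> t; rewrite ab1 -mulrDl subrK mul1r ivalK.
Qed.

Lemma homotopic_concatA f g h : continuous f -> continuous g -> continuous h ->
  f one = g zero -> g one = h zero ->
  homotopic_rel (concat (concat f g) h) (concat f (concat g h)).
Proof.
move=> cf cg ch fg gh.
pose K := concat f (concat g h).
pose a (s : I) : I := clamp (Num.min (Num.min (2 * ival s) (ival s + 4^-1))
                                     ((ival s + 1) / 2)).
have cK : continuous K.
  apply: concat_continuous => //; last by rewrite concat0.
  exact: concat_continuous.
have ca : continuous a.
  apply: cts_clamp; have ci := cts_ival (@cts_id I).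
  have cc (c : R) : continuous (fun _ : I => c) by exact: cts_cst.
  move=> s; apply: (@continuous_min _ _
    (fun s => Num.min (2 * ival s) (ival s + 4^-1) : R^o)
    (fun s => (ival s + 1) / 2 : R^o)).
    apply: (@continuous_min _ _ (fun s => 2 * ival s : R^o)
       (fun s => ival s + 4^-1 : R^o)).
      exact: ctsM.
    exact: ctsD.
  by apply: ctsM => //; exact: ctsD.
have -> : concat (concat f g) h = fun s => K (a s).
  apply/funext => s; rewrite /K /a /concat.
  have s0 := ival_ge0 s; have s1 := ival_le1 s.
  have [s2|s2] := leP (2 * ival s) 1.
    rewrite clampK; last by apply/andP; split; lra.
    have [s4|s4] := leP (2 * (2 * ival s)) 1.
      rewrite (min_l (_ : 2 * ival s <= ival s + 4^-1)); last by lra.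
      rewrite (min_l (_ : 2 * ival s <= (ival s + 1) / 2)); last by lra.
      rewrite clampK; last by apply/andP; split; lra.
      by rewrite s4.
    rewrite (min_r (_ : ival s + 4^-1 <= 2 * ival s)); last by lra.
    rewrite (min_l (_ : ival s + 4^-1 <= (ival s + 1) / 2)); last by lra.
    rewrite clampK; last by apply/andP; split; lra.
    rewrite ifF; last by apply/negbTE; rewrite -ltNge; lra.
    rewrite clampK; last by apply/andP; split; lra.
    rewrite ifT; last by lra.
    by congr (g (clamp _)); lra.
  rewrite (min_r (_ : (ival s + 1) / 2 <= Num.min (2 * ival s) (ival s + 4^-1))); last first.
    by rewrite le_min; apply/andP; split; lra.
  rewrite clampK; last by apply/andP; split; lra.
  rewrite ifF; last by apply/negbTE; rewrite -ltNge; lra.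
  rewrite clampK; last by apply/andP; split; lra.
  rewrite ifF; last by apply/negbTE; rewrite -ltNge; lra.
  by congr (h (clamp _)); lra.
have a0 : a zero = zero.
  apply: ival_inj; rewrite /a ival0 mulr0 !add0r.
  rewrite (min_l (_ : 0 <= 4^-1 :> R)); last by lra.
  by rewrite min_l ?clampK //; lra.
have a1 : a one = one.
  apply: ival_inj; rewrite /a ival1 mulr1.
  rewrite (min_r (_ : 1 + 4^-1 <= 2 :> R)); last by lra.
  rewrite min_r; last by lra.
  by rewrite clampK; lra.
by apply: (@homotopic_reparam K a id) => //; exact: cts_id.
Qed.

Lemma homotopic_concat1l f : continuous f ->
  homotopic_rel (concat (fun=> f zero) f) f.
Proof.
move=> cf.
have -> : concat (fun=> f zero) f = fun s => f (clamp (2 * ival s - 1)).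
  apply/funext => s; rewrite /concat; case: ifP => // s2; congr f.
  have s0 := ival_ge0 s.
  by apply: ival_inj; rewrite ival0 clampE min_l ?max_l //; lra.
apply: (@homotopic_reparam f (fun s => clamp (2 * ival s - 1)) id) => //.
- apply: cts_clamp; apply: ctsB; last exact: cts_cst.
  by apply: ctsM; [exact: cts_cst|exact: cts_ival cts_id].
- exact: cts_id.
- by apply: ival_inj; rewrite ival0 clampE min_l ?max_l //; lra.
- by apply: ival_inj; rewrite ival1 clampK; lra.
Qed.

Lemma homotopic_concat1r f : continuous f ->
  homotopic_rel (concat f (fun=> f one)) f.
Proof.
move=> cf.
have -> : concat f (fun=> f one) = fun s => f (clamp (2 * ival s)).
  apply/funext => s; rewrite /concat; case: leP => // s2; congr f.
  by apply: ival_inj; rewrite ival1 clampE min_r ?max_r //; lra.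
apply: (@homotopic_reparam f (fun s => clamp (2 * ival s)) id) => //.
- by apply: cts_clamp; apply: ctsM; [exact: cts_cst|exact: cts_ival cts_id].
- exact: cts_id.
- by apply: ival_inj; rewrite ival0 clampK; lra.
- by apply: ival_inj; rewrite ival1 clampE min_r ?max_r //; lra.
Qed.

Lemma homotopic_concatV f : continuous f ->
  homotopic_rel (concat f (path_rev f)) (fun=> f zero).
Proof.
move=> cf.
pose a (s : I) : I := clamp (Num.min (2 * ival s) (2 - 2 * ival s)).
have -> : concat f (path_rev f) = fun s => f (a s).
  apply/funext => s; rewrite /concat /path_rev /a.
  have s0 := ival_ge0 s; have s1 := ival_le1 s.
  case: leP => s2; first by rewrite min_l //; lra.
  rewrite (min_r (_ : 2 - 2 * ival s <= 2 * ival s)); last by lra.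
  rewrite clampK; last by apply/andP; split; lra.
  by congr (f (clamp _)); lra.
apply: (@homotopic_reparam f a (fun=> zero)) => //.
- apply: cts_clamp; have ci := cts_ival (@cts_id I).
  have cc (c : R) : continuous (fun _ : I => c) by exact: cts_cst.
  move=> s; apply: (@continuous_min _ _ (fun s => 2 * ival s : R^o)
    (fun s => 2 - 2 * ival s : R^o)); first exact: ctsM.
  by apply: ctsB => //; exact: ctsM.
- exact: cts_cst.
- by apply: ival_inj; rewrite /a ival0 mulr0 subr0 min_l ?clampK //; lra.
- by apply: ival_inj; rewrite /a ival1 ival0 mulr1 subrr min_r ?clampK //; lra.
Qed.

Lemma path_revK f : path_rev (path_rev f) = f.
Proof.
apply/funext => s; rewrite /path_rev clampK; last first.
  by have := ival_ge0 s; have := ival_le1 s; move=> ? ?; apply/andP; split; lra.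
by rewrite opprB addrC subrK ivalK.
Qed.

Lemma homotopic_concatVr f : continuous f ->
  homotopic_rel (concat (path_rev f) f) (fun=> f one).
Proof.
move=> cf; rewrite -{2}[f]path_revK -(path_rev0 f).
by apply: homotopic_concatV; exact: path_rev_continuous.
Qed.

Lemma homotopic_rev f g : homotopic_rel f g ->
  homotopic_rel (path_rev f) (path_rev g).
Proof.
move=> [H [cH H0 H1 Hz Ho]].
exists (fun p => H (clamp (1 - ival p.1), p.2)); split => /=.
- apply: cts_comp cH; apply: cts_pair; last exact: cts_snd.
  by apply: cts_clamp; apply: ctsB; [exact: cts_cst|exact: cts_ival cts_fst].
- by [].
- by [].
- by move=> t; rewrite ival0 subr0 path_rev0.
- by move=> t; rewrite ival1 subrr path_rev1.
Qed.

End homotopy.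

Lemma homotopic_comp {R : realType} {T U : topologicalType} (phi : T -> U)
    (f g : unit_interval R -> T) : continuous phi ->
  homotopic_rel f g -> homotopic_rel (phi \o f) (phi \o g).
Proof.
move=> cphi [H [cH H0 H1 Hz Ho]].
exists (phi \o H); split => /=; first exact: cts_comp cH cphi.
- by move=> s; rewrite H0.
- by move=> s; rewrite H1.
- by move=> t; rewrite Hz.
- by move=> t; rewrite Ho.
Qed.

Lemma comp_concat {R : realType} {T U : topologicalType} (phi : T -> U)
    (f g : unit_interval R -> T) :
  phi \o concat f g = concat (phi \o f) (phi \o g).
Proof. by apply/funext => s; rewrite /concat /=; case: ifP. Qed.

Section path_ops.
Context {R : realType} {T : topologicalType}.
Local Notation I := (unit_interval R).

Definition path_cst (x : T) : {path I from x to x in T} :=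
  mk_path (@cts_cst I T x) erefl erefl.

Lemma path0 (x y : T) (p : {path I from x to y in T}) : p zero = x.
Proof. exact: path_zero. Qed.

Lemma path1 (x y : T) (p : {path I from x to y in T}) : p one = y.
Proof. exact: path_one. Qed.

Section concat.
Context {x y z : T} (p : {path I from x to y in T}) (q : {path I from y to z in T}).

Fact path_concat_subproof : p one = q zero.
Proof. by rewrite path_one path_zero. Qed.

Definition path_concat : {path I from x to z in T} :=
  mk_path (concat_continuous (@cts_fun _ _ p) (@cts_fun _ _ q)
             path_concat_subproof)
    (etrans (concat0 p q) path_zero) (etrans (concat1 p q) path_one).

Definition path_inv : {path I from y to x in T} :=
  mk_path (path_rev_continuous (@cts_fun _ _ p))
    (etrans (path_rev0 p) path_one) (etrans (path_rev1 p) path_zero).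

End concat.
End path_ops.

Section fundamental_group.
Local Open Scope quotient_scope.
Context (R : realType) (T : topologicalType) (x : T).
Local Notation I := (unit_interval R).
Local Notation loop := {path I from x to x in T}.

Definition loop_homotopic : rel loop := fun p q => `[< homotopic_rel p q >].

Fact loop_homotopic_refl : reflexive loop_homotopic.
Proof. by move=> p; apply/asboolP/homotopic_refl; exact: cts_fun. Qed.

Fact loop_homotopic_sym : symmetric loop_homotopic.
Proof. by move=> p q; apply/asboolP/asboolP => /homotopic_sym. Qed.

Fact loop_homotopic_trans : transitive loop_homotopic.
Proof.
by move=> q p r /asboolP pq /asboolP qr; apply/asboolP; exact: homotopic_trans pq qr.
Qed.

Canonical loop_homotopic_equiv := EquivRel loop_homotopic
  loop_homotopic_refl loop_homotopic_sym loop_homotopic_trans.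

Definition pi1 : Type := {eq_quot loop_homotopic_equiv}.

HB.instance Definition _ := Choice.on pi1.
HB.instance Definition _ := EqQuotient.on pi1.

Definition pi1_class (p : loop) : pi1 := \pi_pi1 p.

Lemma pi1W (P : pi1 -> Prop) : (forall p, P (pi1_class p)) -> forall a, P a.
Proof. by move=> h; elim/quotW. Qed.

Lemma pi1_eqP (p q : loop) : pi1_class p = pi1_class q <-> homotopic_rel p q.
Proof. by split=> [/eqmodP/asboolP|h]; [|apply/eqmodP/asboolP]. Qed.

Lemma repr_homotopic (p : loop) : homotopic_rel (repr (pi1_class p)) p.
Proof. by apply/pi1_eqP; exact: reprK. Qed.

Definition pi1_one : pi1 := pi1_class (path_cst x).
Definition pi1_mul (a b : pi1) : pi1 := pi1_class (path_concat (repr a) (repr b)).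
Definition pi1_inv (a : pi1) : pi1 := pi1_class (path_inv (repr a)).

Lemma pi1_mulE (p q : loop) :
  pi1_mul (pi1_class p) (pi1_class q) = pi1_class (path_concat p q).
Proof.
apply/pi1_eqP; apply: homotopic_concat; try exact: repr_homotopic.
exact: path_concat_subproof.
Qed.

Lemma pi1_invE (p : loop) : pi1_inv (pi1_class p) = pi1_class (path_inv p).
Proof. by apply/pi1_eqP/homotopic_rev/repr_homotopic. Qed.

Fact pi1_mulA : associative pi1_mul.
Proof.
elim/pi1W=> p; elim/pi1W=> q; elim/pi1W=> r; rewrite !pi1_mulE.
apply/pi1_eqP/homotopic_sym.
apply: (@homotopic_concatA R T p q r); try exact: cts_fun;
  exact: path_concat_subproof.
Qed.

Fact pi1_mul1 : left_id pi1_one pi1_mul.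
Proof.
elim/pi1W=> p; rewrite pi1_mulE; apply/pi1_eqP.
have := @homotopic_concat1l R T p (@cts_fun _ _ p).
by rewrite path0.
Qed.

Fact pi1_mulr1 : right_id pi1_one pi1_mul.
Proof.
elim/pi1W=> p; rewrite pi1_mulE; apply/pi1_eqP.
have := @homotopic_concat1r R T p (@cts_fun _ _ p).
by rewrite path1.
Qed.

Fact pi1_mulVr : left_inverse pi1_one pi1_inv pi1_mul.
Proof.
elim/pi1W=> p; rewrite pi1_invE pi1_mulE; apply/pi1_eqP.
have := @homotopic_concatVr R T p (@cts_fun _ _ p).
by rewrite path1.
Qed.

Fact pi1_mulrV : right_inverse pi1_one pi1_inv pi1_mul.
Proof.
elim/pi1W=> p; rewrite pi1_invE pi1_mulE; apply/pi1_eqP.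
have := @homotopic_concatV R T p (@cts_fun _ _ p).
by rewrite path0.
Qed.

HB.instance Definition _ := isGroup.Build pi1
  pi1_mulA pi1_mul1 pi1_mulr1 pi1_mulVr pi1_mulrV.

Lemma pi1_classM (p q : loop) :
  pi1_class (path_concat p q) = (pi1_class p * pi1_class q)%g.
Proof. by rewrite -pi1_mulE. Qed.

End fundamental_group.

Section pi1_map.
Context (R : realType) {T U : topologicalType} (f : continuousType T U) (x : T).

Definition pi1_map (a : pi1 R x) : pi1 R (f x) :=
  pi1_class (f \o (repr a : {path _ from x to x in T})).

Lemma pi1_mapE (p : {path unit_interval R from x to x in T}) :
  pi1_map (pi1_class p) = pi1_class (f \o p).
Proof.
apply/pi1_eqP; apply: homotopic_comp; first exact: cts_fun.
exact: repr_homotopic.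
Qed.

Lemma pi1_mapM : {morph pi1_map : a b / (a * b)%g}.
Proof.
elim/pi1W=> p; elim/pi1W=> q;
rewrite -pi1_classM !pi1_mapE -pi1_classM; congr pi1_class.
by apply/path_eqP => s; exact: (congr1 (@^~ s) (comp_concat f p q)).
Qed.

End pi1_map.

Local Open Scope quotient_scope.

(* Locally Euclidean without boundary, [f : U -> f @` U] being a chart at [p]
   with inverse [g]. *)
Definition topological_manifold (R : realType) (m : nat) (M : topologicalType) :=
  [/\ hausdorff_space M, @second_countable M &
      forall p : M, exists (U : set M) (f : M -> 'rV[R]_m) (g : 'rV[R]_m -> M),
        [/\ open U /\ U p, open (f @` U), {within U, continuous f},
            {within f @` U, continuous g} & {in U, cancel f g}]].

Record continuous_action (G : finGroupType) (M : topologicalType) :=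
  ContinuousAction {
    cact :> G -> M -> M;
    cact1 : forall y, cact 1%g y = y;
    cactM : forall g h y, cact (g * h)%g y = cact g (cact h y);
    cact_continuous : forall g, continuous (cact g) }.

Section action.
Context {G : finGroupType} {M : topologicalType} (a : continuous_action G M).

Definition effective := forall g, (forall y, a g y = y) -> g = 1%g.

Definition act_orbit (y : M) : set M := [set a g y | g in [set: G]].

Definition isotropy (y : M) : set G := [set g | a g y = y].

Definition free_type (O : set M) := forall y, O y -> isotropy y = [set 1%g].

Lemma cactK g : cancel (a g) (a g^-1%g).
Proof. by move=> y; rewrite -cactM mulVg cact1. Qed.

Lemma act_orbit_refl y : act_orbit y y.
Proof. by exists 1%g => //; rewrite cact1. Qed.

Lemma act_orbit_act g y : act_orbit y (a g y).
Proof. by exists g. Qed.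

Lemma act_orbitJ g y : act_orbit (a g y) `<=` act_orbit y.
Proof. by move=> _ [h _ <-]; exists (h * g)%g => //; rewrite cactM. Qed.

Lemma free_typeP y g h : free_type (act_orbit y) -> a g y = a h y -> g = h.
Proof.
move=> yf e; have : isotropy y (h^-1 * g)%g by rewrite /isotropy /= cactM e cactK.
rewrite (yf _ (act_orbit_refl y)) => /= hg.
by rewrite -[g](mulKVg h) hg mulg1.
Qed.

End action.

(* [permute s y] is [y_sigma], and [twist g s y] below is [g y_sigma]. *)
Definition permute {T : Type} {n : nat} (s : 'S_n) (y : 'I_n -> T) : 'I_n -> T :=
  fun i => y (s i).

Section configurations.
Context (M : topologicalType) (n : nat).

(* The space [F(M, n)]; its quotient by the symmetric group is
   [unordered_conf]. *)
Definition conf : set {ptws 'I_n -> M} :=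
  [set y | forall i j, i <> j -> y i <> y j].

Fact conf_perm_subproof (s : 'S_n) (y : conf) :
  permute s (set_val y) \in conf.
Proof.
rewrite inE => i j ij; have : conf (set_val y) by exact: set_valP.
by apply => /perm_inj.
Qed.

Definition conf_perm (s : 'S_n) (y : conf) : conf :=
  @exist _ (fun y => y \in conf) _ (conf_perm_subproof s y).

Lemma conf_perm1 y : conf_perm 1 y = y.
Proof. by apply: val_inj; apply/funext => i /=; rewrite /permute perm1. Qed.

Lemma conf_permM s t y : conf_perm s (conf_perm t y) = conf_perm (s * t) y.
Proof. by apply: val_inj; apply/funext => i /=; rewrite /permute permM. Qed.

Definition conf_equiv : rel conf := fun y z => `[< exists s, z = conf_perm s y >].

Fact conf_equiv_refl : reflexive conf_equiv.
Proof. by move=> y; apply/asboolP; exists 1%g; rewrite conf_perm1. Qed.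

Fact conf_equiv_sym : symmetric conf_equiv.
Proof.
suff h y z : conf_equiv y z -> conf_equiv z y.
  by move=> y z; apply/idP/idP; exact: h.
move=> /asboolP[s ->]; apply/asboolP; exists (s^-1)%g.
by rewrite conf_permM mulVg conf_perm1.
Qed.

Fact conf_equiv_trans : transitive conf_equiv.
Proof.
move=> z y w /asboolP[s ->] /asboolP[t ->]; apply/asboolP; exists (t * s)%g.
by rewrite conf_permM.
Qed.

Canonical conf_equivRel :=
  EquivRel conf_equiv conf_equiv_refl conf_equiv_sym conf_equiv_trans.

Definition unordered_conf : Type := quotient_topology {eq_quot conf_equivRel}.

HB.instance Definition _ := Topological.on unordered_conf.
HB.instance Definition _ := Quotient.on unordered_conf.

Definition conf_quot (y : conf) : unordered_conf := \pi_unordered_conf y.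

Lemma conf_quot_perm s y : conf_quot (conf_perm s y) = conf_quot y.
Proof.
by apply/esym/eqmodP/asboolP; exists s.
Qed.

Fact conf_quot_continuous : continuous conf_quot.
Proof. exact: pi_continuous. Qed.

HB.instance Definition _ :=
  isContinuous.Build _ _ conf_quot conf_quot_continuous.

End configurations.

Arguments conf : clear implicits.
Arguments unordered_conf : clear implicits.

Section orbit_configurations.
Local Open Scope group_scope.
Context {G : finGroupType} {M : topologicalType} (a : continuous_action G M).
Context (n : nat).

(* The space [F_G(M, n)] *)
Definition orbit_conf : set {ptws 'I_n -> M} :=
  [set y | forall i j, i <> j -> act_orbit a (y i) `&` act_orbit a (y j) = set0].

Definition twist (g : {ffun 'I_n -> G}) (s : 'S_n) (y : 'I_n -> M) : 'I_n -> M :=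
  fun i => a (g i) (permute s y i).

Lemma twist11 y : twist 1 1 y = y.
Proof. by apply/funext => i; rewrite /twist /permute ffunE cact1 perm1. Qed.

Lemma twistM g s h t y :
  twist g s (twist h t y) = twist (g * [ffun i => h (s i)])%g (s * t)%g y.
Proof.
by apply/funext => i; rewrite /twist /permute !ffunE -cactM permM.
Qed.

Lemma twist1s s y : twist 1 s y = permute s y.
Proof. by apply/funext => i; rewrite /twist ffunE cact1. Qed.

Fact orbit_conf_twist_subproof g s (y : orbit_conf) :
  twist g s (set_val y) \in orbit_conf.
Proof.
rewrite inE => i j ij; apply/seteqP; split=> [z [/act_orbitJ yi /act_orbitJ yj]|//].
have /(_ (s i) (s j)) yij : orbit_conf (set_val y) by exact: set_valP.
by rewrite -yij; [split|move=> /perm_inj].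
Qed.

Definition orbit_conf_twist g s (y : orbit_conf) : orbit_conf :=
  @exist _ (fun y => y \in orbit_conf) _ (orbit_conf_twist_subproof g s y).

Lemma orbit_conf_twist11 y : orbit_conf_twist 1 1 y = y.
Proof. by apply: val_inj; exact: twist11. Qed.

Lemma orbit_conf_twistM g s h t y :
  orbit_conf_twist g s (orbit_conf_twist h t y) =
  orbit_conf_twist (g * [ffun i => h (s i)])%g (s * t)%g y.
Proof. by apply: val_inj; exact: twistM. Qed.

Lemma orbit_conf_twist_continuous g s : continuous (orbit_conf_twist g s).
Proof.
apply: continuous_initial; apply: continuous_ptws => i.
apply: (cts_comp (g := a (g i))); last exact: cact_continuous.
apply: (cts_comp (f := set_val) (g := fun y : {ptws 'I_n -> M} => y (s i))).
  exact: initial_continuous.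
exact: continuous_ptws_proj.
Qed.

Fact orbit_conf_permute_subproof s (y : orbit_conf) :
  permute s (set_val y) \in orbit_conf.
Proof. by rewrite -twist1s; exact: orbit_conf_twist_subproof. Qed.

Definition orbit_conf_perm s (y : orbit_conf) : orbit_conf :=
  @exist _ (fun y => y \in orbit_conf) _ (orbit_conf_permute_subproof s y).

Lemma orbit_conf_twist1 s y : orbit_conf_twist 1 s y = orbit_conf_perm s y.
Proof. by apply: val_inj; exact: twist1s. Qed.

Fact orbit_conf_sub (y : orbit_conf) : set_val y \in conf M n.
Proof.
rewrite inE => i j ij e.
have /(_ i j ij) : orbit_conf (set_val y) by exact: set_valP.
by rewrite e setIid => /seteqP[+ _] => /(_ _ (act_orbit_refl a _)).
Qed.

Definition conf_embed (y : orbit_conf) : conf M n :=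
  @exist _ (fun y => y \in conf M n) _ (orbit_conf_sub y).

Fact conf_embed_continuous : continuous conf_embed.
Proof. by apply: continuous_initial; exact: initial_continuous. Qed.

HB.instance Definition _ :=
  isContinuous.Build _ _ conf_embed conf_embed_continuous.

Lemma conf_embed_perm s y :
  conf_embed (orbit_conf_perm s y) = conf_perm s (conf_embed y).
Proof. exact: val_inj. Qed.

Definition twist_invg (g : {ffun 'I_n -> G}) (s : 'S_n) : {ffun 'I_n -> G} :=
  [ffun i => (g ((s^-1)%g i))^-1%g].

Lemma orbit_conf_twistV g s :
  cancel (orbit_conf_twist g s) (orbit_conf_twist (twist_invg g s) s^-1).
Proof.
move=> y; rewrite orbit_conf_twistM mulVg.
rewrite (_ : (_ * _)%g = 1%g) ?orbit_conf_twist11 //.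
by apply/ffunP => i; rewrite !ffunE mulVg.
Qed.

Lemma orbit_conf_twistVr g s :
  cancel (orbit_conf_twist (twist_invg g s) s^-1) (orbit_conf_twist g s).
Proof.
move=> y; rewrite orbit_conf_twistM mulgV.
rewrite (_ : (_ * _)%g = 1%g) ?orbit_conf_twist11 //.
by apply/ffunP => i; rewrite !ffunE permK mulgV.
Qed.

Lemma twist_inj (x : orbit_conf) g s h t :
  (forall i, free_type a (act_orbit a (set_val x i))) ->
  orbit_conf_twist g s x = orbit_conf_twist h t x -> g = h /\ s = t.
Proof.
move=> xfree /(congr1 (fun y : orbit_conf => set_val y)) e0.
have e : twist g s (set_val x) = twist h t (set_val x) := e0.
have st i : s i = t i.
  apply: contrapT => sti.
  have /(_ _ _ sti) : orbit_conf (set_val x) by exact: set_valP.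
  move=> /seteqP[+ _] => /(_ (twist g s (set_val x) i)); apply; split.
    exact: act_orbit_act.
  by rewrite e; exact: act_orbit_act.
split; last exact/permP.
apply/ffunP => i; apply: (free_typeP (xfree (t i))).
by have := congr1 (fun y => y i) e; rewrite /twist /permute st.
Qed.

End orbit_configurations.

Arguments orbit_conf {G M} a n _.

Section orbit_braids.
Local Open Scope group_scope.
Context (R : realType) {G : finGroupType} {M : topologicalType}.
Context (a : continuous_action G M) (n : nat).
Local Notation I := (unit_interval R).

(* A string is a subset of [M * I]. The orbit string of [f] is the set of the
   strings of its translates, not their union: two paths that switch branches
   at a point with nontrivial isotropy have distinct orbit strings. *)
Definition string (f : I -> M) : set (M * I) := [set (f s, s) | s in [set: I]].

Definition orbit_string (f : I -> M) : set (set (M * I)) :=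
  [set string (fun s => a h (f s)) | h in [set: G]].

Definition orbit_braid (al : I -> orbit_conf a n) : set (set (set (M * I))) :=
  [set orbit_string (fun s => set_val (al s) i) | i in [set: 'I_n]].

Definition orbit_braid_equiv (c d : set (set (set (M * I)))) :=
  exists al be : I -> orbit_conf a n,
    [/\ continuous al, continuous be, orbit_braid al = c, orbit_braid be = d &
        homotopic_rel al be].

Lemma string_inj f g : string f = string g -> f =1 g.
Proof.
move=> /seteqP[fg _] s; have [|t _ [<- <-] //] := fg (f s, s).
by exists s.
Qed.

Lemma orbit_braid_eq al be : orbit_braid al = orbit_braid be ->
  exists g s, forall t, al t = orbit_conf_twist g s (be t).
Proof.
move=> e.
have h i : exists jh : 'I_n * G,
    forall t, set_val (al t) i = a jh.2 (set_val (be t) jh.1).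
  have : orbit_braid be (orbit_string (fun s => set_val (al s) i)).
    by rewrite -e; exists i.
  move=> [j _ ej].
  have : orbit_string (fun s => set_val (al s) i) (string (fun s => set_val (al s) i)).
    by exists 1 => //; congr string; apply/funext => s; rewrite cact1.
  by rewrite -ej => -[k _ /string_inj ek]; exists (j, k) => t; rewrite -ek.
have [f fP] := choice h.
have finj : injective (fun i => (f i).1).
  move=> i i' fii; apply: contrapT => ii.
  have /(_ i i' ii) : orbit_conf a n (set_val (al zero)) by exact: set_valP.
  rewrite !fP fii.
  move=> /seteqP[+ _] => /(_ (set_val (be zero) (f i').1)); apply.
  by split; [exists (f i).2^-1|exists (f i').2^-1] => //; rewrite cactK.
exists [ffun i => (f i).2], (perm finj) => t; apply: val_inj; apply/funext => i.
by rewrite [LHS]fP /= /twist /permute ffunE permE.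
Qed.

Context (x : orbit_conf a n).

(* The pair [(op_g, op_s)] is determined by the path when the coordinates of [x]
   have orbits of free type, see [twist_inj]. *)
Record orbit_path := OrbitPath {
  op_g : {ffun 'I_n -> G};
  op_s : 'S_n;
  op_path :> {path I from x to orbit_conf_twist op_g op_s x in orbit_conf a n} }.

HB.instance Definition _ := gen_eqMixin orbit_path.
HB.instance Definition _ := gen_choiceMixin orbit_path.

Hypothesis xfree : forall i, free_type a (act_orbit a (set_val x i)).

Lemma orbit_braid_equivP (al be : orbit_path) :
  orbit_braid_equiv (orbit_braid al) (orbit_braid be) <-> homotopic_rel al be.
Proof.
split=> [|h]; last first.
  by exists al, be; split => //; exact: cts_fun.
move=> [al' [be' [cal cbe /orbit_braid_eq[g [s e]] /orbit_braid_eq[h [t f]]]]].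
move=> /[dup] /homotopic_ends[+ _].
move=> z0; rewrite e f !path0 in z0.
have [gh st] := twist_inj xfree z0.
move=> /(homotopic_comp (@orbit_conf_twist_continuous _ _ a n (twist_invg g s) s^-1)).
congr homotopic_rel; apply/funext => r /=.
  by rewrite e orbit_conf_twistV.
by rewrite f gh st orbit_conf_twistV.
Qed.

Definition orbit_path_equiv : rel orbit_path :=
  fun al be => `[< orbit_braid_equiv (orbit_braid al) (orbit_braid be) >].

Fact orbit_path_equiv_refl : reflexive orbit_path_equiv.
Proof.
by move=> p; apply/asboolP/orbit_braid_equivP/homotopic_refl; exact: cts_fun.
Qed.

Fact orbit_path_equiv_sym : symmetric orbit_path_equiv.
Proof.
by move=> p q; apply/asboolP/asboolP => /orbit_braid_equivP/homotopic_sym h;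
  apply/orbit_braid_equivP.
Qed.

Fact orbit_path_equiv_trans : transitive orbit_path_equiv.
Proof.
move=> q p r /asboolP/orbit_braid_equivP pq /asboolP/orbit_braid_equivP qr.
by apply/asboolP/orbit_braid_equivP; exact: homotopic_trans pq qr.
Qed.

Canonical orbit_path_equivRel := EquivRel orbit_path_equiv
  orbit_path_equiv_refl orbit_path_equiv_sym orbit_path_equiv_trans.

(* [B_n^orb(M, G)] *)
Definition orbit_braid_group : Type := {eq_quot orbit_path_equivRel}.

HB.instance Definition _ := Choice.on orbit_braid_group.
HB.instance Definition _ := EqQuotient.on orbit_braid_group.

Definition orbit_class (al : orbit_path) : orbit_braid_group :=
  \pi_orbit_braid_group al.

Lemma orbit_classW (P : orbit_braid_group -> Prop) :
  (forall al, P (orbit_class al)) -> forall c, P c.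
Proof. by move=> h; elim/quotW. Qed.

Lemma orbit_class_eqP (al be : orbit_path) :
  orbit_class al = orbit_class be <-> homotopic_rel al be.
Proof.
split=> [/eqmodP/asboolP/orbit_braid_equivP //|h].
by apply/eqmodP/asboolP/orbit_braid_equivP.
Qed.

Lemma orbit_class_eq_end (al be : orbit_path) :
  orbit_class al = orbit_class be -> op_g al = op_g be /\ op_s al = op_s be.
Proof.
move=> /orbit_class_eqP/homotopic_ends[_]; rewrite !path1.
exact: twist_inj.
Qed.

Lemma repr_orbit (al : orbit_path) : homotopic_rel (repr (orbit_class al)) al.
Proof. by apply/orbit_class_eqP; exact: reprK. Qed.

Lemma repr_orbit_end (al : orbit_path) :
  op_g (repr (orbit_class al)) = op_g al /\ op_s (repr (orbit_class al)) = op_s al.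
Proof. by apply: orbit_class_eq_end; exact: reprK. Qed.

Section ops.
Implicit Types al be : orbit_path.

Fact orbit_path_one_subproof : x = orbit_conf_twist 1 1 x.
Proof. by rewrite orbit_conf_twist11. Qed.

Definition orbit_path_one : orbit_path :=
  OrbitPath (mk_path (@cts_cst I _ x) erefl orbit_path_one_subproof).

(* [al] followed by [g be_sigma], where [al] ends at [g x_sigma] *)
Definition orbit_concat al be : I -> orbit_conf a n :=
  concat al (orbit_conf_twist (op_g al) (op_s al) \o be).

Fact orbit_concat_continuous al be : continuous (orbit_concat al be).
Proof.
apply: concat_continuous; first exact: cts_fun.
  by apply: cts_comp (@orbit_conf_twist_continuous _ _ a n _ _); exact: cts_fun.
by rewrite path1 /= path0.
Qed.

Fact orbit_concat0 al be : orbit_concat al be zero = x.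
Proof. by rewrite /orbit_concat concat0 path0. Qed.

Fact orbit_concat1 al be : orbit_concat al be one =
  orbit_conf_twist (op_g al * [ffun i => op_g be (op_s al i)])
    (op_s al * op_s be) x.
Proof. by rewrite /orbit_concat concat1 /= path1 orbit_conf_twistM. Qed.

Definition orbit_path_mul al be : orbit_path :=
  OrbitPath (mk_path (@orbit_concat_continuous al be)
    (orbit_concat0 al be) (orbit_concat1 al be)).

Definition orbit_rev al : I -> orbit_conf a n :=
  orbit_conf_twist (twist_invg (op_g al) (op_s al)) (op_s al)^-1 \o path_rev al.

Fact orbit_rev_continuous al : continuous (orbit_rev al).
Proof.
apply: cts_comp (@orbit_conf_twist_continuous _ _ a n _ _).
by apply: path_rev_continuous; exact: cts_fun.
Qed.

Fact orbit_rev0 al : orbit_rev al zero = x.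
Proof. by rewrite /orbit_rev /= path_rev0 path1 orbit_conf_twistV. Qed.

Fact orbit_rev1 al : orbit_rev al one =
  orbit_conf_twist (twist_invg (op_g al) (op_s al)) (op_s al)^-1 x.
Proof. by rewrite /orbit_rev /= path_rev1 path0. Qed.

Definition orbit_path_inv al : orbit_path :=
  OrbitPath (mk_path (@orbit_rev_continuous al) (orbit_rev0 al) (orbit_rev1 al)).

Definition orbit_one : orbit_braid_group := orbit_class orbit_path_one.
Definition orbit_mul (c d : orbit_braid_group) : orbit_braid_group :=
  orbit_class (orbit_path_mul (repr c) (repr d)).
Definition orbit_inv (c : orbit_braid_group) : orbit_braid_group :=
  orbit_class (orbit_path_inv (repr c)).

Lemma orbit_twist_repr al : orbit_conf_twist
    (op_g (repr (orbit_class al))) (op_s (repr (orbit_class al))) =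
  orbit_conf_twist (a := a) (op_g al) (op_s al).
Proof. by have [-> ->] := repr_orbit_end al. Qed.

Lemma orbit_twistV_repr al : orbit_conf_twist
    (twist_invg (op_g (repr (orbit_class al))) (op_s (repr (orbit_class al))))
    (op_s (repr (orbit_class al)))^-1 =
  orbit_conf_twist (a := a) (twist_invg (op_g al) (op_s al)) (op_s al)^-1.
Proof. by have [-> ->] := repr_orbit_end al. Qed.

Let homotopic_comp_eq (phi psi : orbit_conf a n -> orbit_conf a n)
    (f g : I -> orbit_conf a n) : phi = psi -> continuous psi ->
  homotopic_rel f g -> homotopic_rel (phi \o f) (psi \o g).
Proof. by move=> ->; exact: homotopic_comp. Qed.

Lemma orbit_mulE al be :
  orbit_mul (orbit_class al) (orbit_class be) = orbit_class (orbit_path_mul al be).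
Proof.
apply/orbit_class_eqP.
apply: homotopic_concat.
- by rewrite path1 /= path0.
- exact: repr_orbit.
- apply: homotopic_comp_eq (orbit_twist_repr al) _ (repr_orbit be).
  exact: orbit_conf_twist_continuous.
Qed.

Lemma orbit_invE al : orbit_inv (orbit_class al) = orbit_class (orbit_path_inv al).
Proof.
apply/orbit_class_eqP.
apply: homotopic_comp_eq (orbit_twistV_repr al) _ (homotopic_rev (repr_orbit al)).
exact: orbit_conf_twist_continuous.
Qed.

Fact orbit_mulA : associative orbit_mul.
Proof.
elim/orbit_classW=> p; elim/orbit_classW=> q; elim/orbit_classW=> r.
rewrite !orbit_mulE; apply/orbit_class_eqP/homotopic_sym.
rewrite /= /mk_path /orbit_concat /= /mk_path /orbit_concat.
rewrite comp_concat.
rewrite (_ : orbit_conf_twist (op_g p * [ffun i => op_g q (op_s p i)])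
   (op_s p * op_s q) \o r = orbit_conf_twist (op_g p) (op_s p) \o
   (orbit_conf_twist (op_g q) (op_s q) \o r)); last first.
  by apply/funext => s; rewrite /= orbit_conf_twistM.
apply: homotopic_concatA.
- exact: cts_fun.
- by apply: cts_comp (@orbit_conf_twist_continuous _ _ a n _ _); exact: cts_fun.
- apply: cts_comp (@orbit_conf_twist_continuous _ _ a n _ _).
  by apply: cts_comp (@orbit_conf_twist_continuous _ _ a n _ _); exact: cts_fun.
- by rewrite path1 /= path0.
- by rewrite /= path1 path0.
Qed.

Fact orbit_mul1 : left_id orbit_one orbit_mul.
Proof.
elim/orbit_classW=> p; rewrite orbit_mulE; apply/orbit_class_eqP.
have := @homotopic_concat1l R _ p (@cts_fun _ _ p); rewrite path0.
congr homotopic_rel; rewrite /= /mk_path /orbit_concat; congr concat.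
by apply/funext => s; rewrite /= orbit_conf_twist11.
Qed.

Fact orbit_mulr1 : right_id orbit_one orbit_mul.
Proof.
elim/orbit_classW=> p; rewrite orbit_mulE; apply/orbit_class_eqP.
have := @homotopic_concat1r R _ p (@cts_fun _ _ p); rewrite path1.
by [].
Qed.

Fact orbit_mulVr : left_inverse orbit_one orbit_inv orbit_mul.
Proof.
elim/orbit_classW=> p; rewrite orbit_invE orbit_mulE; apply/orbit_class_eqP.
have := @homotopic_concatVr R _ p (@cts_fun _ _ p); rewrite path1.
move=> /(homotopic_comp (@orbit_conf_twist_continuous _ _ a n
   (twist_invg (op_g p) (op_s p)) (op_s p)^-1)).
rewrite comp_concat; congr homotopic_rel.
by apply/funext => s; rewrite /= orbit_conf_twistV.
Qed.

Fact orbit_mulrV : right_inverse orbit_one orbit_inv orbit_mul.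
Proof.
elim/orbit_classW=> p; rewrite orbit_invE orbit_mulE; apply/orbit_class_eqP.
have := @homotopic_concatV R _ p (@cts_fun _ _ p); rewrite path0.
congr homotopic_rel; rewrite /= /mk_path /orbit_concat; congr concat.
by apply/funext => s; rewrite /= orbit_conf_twistVr.
Qed.

End ops.

HB.instance Definition _ := isGroup.Build orbit_braid_group
  orbit_mulA orbit_mul1 orbit_mulr1 orbit_mulVr orbit_mulrV.

Lemma orbit_classM (al be : orbit_path) :
  orbit_class (orbit_path_mul al be) = (orbit_class al * orbit_class be)%g.
Proof. by rewrite -orbit_mulE. Qed.

Lemma orbit_classV (al : orbit_path) :
  orbit_class (orbit_path_inv al) = ((orbit_class al)^-1)%g.
Proof. by rewrite -orbit_invE. Qed.

End orbit_braids.

Section braids.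
Context (R : realType) (M : topologicalType) (n : nat) (y : conf M n).
Local Notation I := (unit_interval R).

(* [P_n(M)] and [B_n(M)] *)
Definition pure_braid_group : Type := pi1 R y.
Definition braid_group : Type := pi1 R (conf_quot y).

HB.instance Definition _ := Group.on pure_braid_group.
HB.instance Definition _ := Group.on braid_group.

Section quot_loop.
Context (s : 'S_n) (al : {path I from y to conf_perm s y in conf M n}).

Fact quot_loop_continuous : continuous (@conf_quot M n \o al).
Proof. exact: cts_fun. Qed.

Fact quot_loop0 : (@conf_quot M n \o al) zero = conf_quot y.
Proof. by rewrite /= path0. Qed.

Fact quot_loop1 : (@conf_quot M n \o al) one = conf_quot y.
Proof. by rewrite /= path1 conf_quot_perm. Qed.

Definition quot_loop : {path I from conf_quot y to conf_quot y in unordered_conf M n} :=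
  mk_path quot_loop_continuous quot_loop0 quot_loop1.

End quot_loop.

Definition pure_braid_incl (c : pure_braid_group) : braid_group :=
  pi1_map (@conf_quot M n) c.

(* The lift starting at [y] of a loop representing [c] ends at [y_sigma]; when M
   is Hausdorff, [conf_quot] is a covering, so [sigma] exists and is unique. *)
Definition braid_perm (c : braid_group) : 'S_n :=
  xget 1%g [set s | exists al : {path I from y to conf_perm s y in conf M n},
                      c = pi1_class (quot_loop al)].

End braids.

Section Gbraids.
Local Open Scope group_scope.
Context (R : realType) {G : finGroupType} {M : topologicalType}.
Context {a : continuous_action G M} {n : nat} (x : orbit_conf a n).
Local Notation I := (unit_interval R).

Section perm_orbit_path.
Context (s : 'S_n) (al : {path I from x to orbit_conf_perm s x in orbit_conf a n}).

Fact perm_orbit_path1 : al one = orbit_conf_twist 1 s x.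
Proof. by rewrite path1 orbit_conf_twist1. Qed.

Definition perm_orbit_path : orbit_path R x :=
  OrbitPath (mk_path (@cts_fun _ _ al) (path0 al) perm_orbit_path1).

Fact embed_path_continuous : continuous (@conf_embed _ _ a n \o al).
Proof. exact: cts_fun. Qed.

Fact embed_path0 : (@conf_embed _ _ a n \o al) zero = conf_embed x.
Proof. by rewrite /= path0. Qed.

Fact embed_path1 :
  (@conf_embed _ _ a n \o al) one = conf_perm s (conf_embed x).
Proof. by rewrite /= path1 conf_embed_perm. Qed.

Definition embed_path :
    {path I from conf_embed x to conf_perm s (conf_embed x) in conf M n} :=
  mk_path embed_path_continuous embed_path0 embed_path1.

End perm_orbit_path.

Section loop_orbit_path.
Context (al : {path I from x to x in orbit_conf a n}).

Fact loop_orbit_path1 : al one = orbit_conf_twist 1 1 x.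
Proof. by rewrite path1 orbit_conf_twist11. Qed.

Definition loop_orbit_path : orbit_path R x :=
  OrbitPath (mk_path (@cts_fun _ _ al) (path0 al) loop_orbit_path1).

Definition embed_loop : {path I from conf_embed x to conf_embed x in conf M n} :=
  @conf_embed _ _ a n \o al.

End loop_orbit_path.

Context (xfree : forall i, free_type a (act_orbit a (set_val x i))).
Local Notation Borb := (orbit_braid_group R xfree).

Definition mem_Gbraid : pred Borb := fun c =>
  `[< exists s (al : {path I from x to orbit_conf_perm s x in orbit_conf a n}),
        c = orbit_class xfree (perm_orbit_path al) >].

Definition mem_pure_Gbraid : pred Borb := fun c =>
  `[< exists al : {path I from x to x in orbit_conf a n},
        c = orbit_class xfree (loop_orbit_path al) >].

Lemma mem_GbraidP (al : orbit_path R x) :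
  mem_Gbraid (orbit_class xfree al) <-> op_g al = 1.
Proof.
split=> [/asboolP[s [be]] /orbit_class_eq_end[] //|].
case: al => g s al /= g1; rewrite g1 in al *.
apply/asboolP; exists s.
have e1 : al one = orbit_conf_perm s x by rewrite path1 orbit_conf_twist1.
exists (mk_path (@cts_fun _ _ al) (path0 al) e1).
by apply/orbit_class_eqP; apply: homotopic_refl; exact: cts_fun.
Qed.

Lemma mem_pure_GbraidP (al : orbit_path R x) :
  mem_pure_Gbraid (orbit_class xfree al) <-> op_g al = 1 /\ op_s al = 1.
Proof.
split=> [/asboolP[be] /orbit_class_eq_end[] //|].
case: al => g s al /= [g1 s1]; rewrite g1 s1 in al *.
apply/asboolP.
have e1 : al one = x by rewrite path1 orbit_conf_twist11.
exists (mk_path (@cts_fun _ _ al) (path0 al) e1).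
by apply/orbit_class_eqP; apply: homotopic_refl; exact: cts_fun.
Qed.

Fact Gbraid_closed : group_closed mem_Gbraid.
Proof.
split; first exact/mem_GbraidP.
elim/orbit_classW=> p; elim/orbit_classW=> q /mem_GbraidP pg /mem_GbraidP qg.
rewrite -orbit_classV -orbit_classM; apply/mem_GbraidP => /=.
by apply/ffunP => i; rewrite pg qg !ffunE invg1 mulg1.
Qed.

Fact pure_Gbraid_closed : group_closed mem_pure_Gbraid.
Proof.
split; first exact/mem_pure_GbraidP.
elim/orbit_classW=> p; elim/orbit_classW=> q.
move=> /mem_pure_GbraidP[pg ps] /mem_pure_GbraidP[qg qs].
rewrite -orbit_classV -orbit_classM; apply/mem_pure_GbraidP => /=.
split; last by rewrite ps qs invg1 mulg1.
by apply/ffunP => i; rewrite pg qg !ffunE invg1 mulg1.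
Qed.

(* [B_n(M, G)] and [P_n(M, G)] *)
Definition Gbraid_group : Type := {c : Borb | mem_Gbraid c}.
HB.instance Definition _ := SubChoice.on Gbraid_group.
HB.instance Definition _ :=
  SubChoice_isSubGroup.Build Borb mem_Gbraid Gbraid_group Gbraid_closed.

Definition pure_Gbraid_group : Type := {c : Borb | mem_pure_Gbraid c}.
HB.instance Definition _ := SubChoice.on pure_Gbraid_group.
HB.instance Definition _ :=
  SubChoice_isSubGroup.Build Borb mem_pure_Gbraid pure_Gbraid_group pure_Gbraid_closed.

Fact pure_Gbraid_sub (c : pure_Gbraid_group) : mem_Gbraid (val c).
Proof.
case: c => /= c; move: c; elim/orbit_classW=> p.
by move=> /mem_pure_GbraidP[pg _]; apply/mem_GbraidP.
Qed.

Definition pure_Gbraid_incl (c : pure_Gbraid_group) : Gbraid_group :=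
  exist _ (val c) (pure_Gbraid_sub c).

Definition Gbraid_perm (c : Gbraid_group) : 'S_n :=
  xget 1 [set s | exists al : {path I from x to orbit_conf_perm s x in orbit_conf a n},
                    val c = orbit_class xfree (perm_orbit_path al)].

Lemma Gbraid_permE (c : Gbraid_group) s
    (al : {path I from x to orbit_conf_perm s x in orbit_conf a n}) :
  val c = orbit_class xfree (perm_orbit_path al) -> Gbraid_perm c = s.
Proof.
move=> cal; apply: xget_unique; first by exists al.
by move=> t [be]; rewrite cal => /orbit_class_eq_end[_ /= ->].
Qed.

(* The homomorphisms induced by [conf_embed]; the classes chosen by [xget] are
   unique, see [Gbraid_to_braidE] and [pure_Gbraid_to_braidE]. *)
Definition Gbraid_to_braid (c : Gbraid_group) : braid_group R (conf_embed x) :=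
  xget 1 [set b | exists s
      (al : {path I from x to orbit_conf_perm s x in orbit_conf a n}),
    val c = orbit_class xfree (perm_orbit_path al) /\
    b = pi1_class (quot_loop (embed_path al))].

Definition pure_Gbraid_to_braid (c : pure_Gbraid_group) :
    pure_braid_group R (conf_embed x) :=
  xget 1 [set b | exists al : {path I from x to x in orbit_conf a n},
    val c = orbit_class xfree (loop_orbit_path al) /\
    b = pi1_class (embed_loop al)].

Lemma Gbraid_to_braidE (c : Gbraid_group) s
    (al : {path I from x to orbit_conf_perm s x in orbit_conf a n}) :
  val c = orbit_class xfree (perm_orbit_path al) ->
  Gbraid_to_braid c = pi1_class (quot_loop (embed_path al)).
Proof.
move=> cal; apply: xget_unique; first by exists s, al.
move=> b [t [be [+ ->]]]; rewrite cal => /orbit_class_eqP h.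
apply/pi1_eqP/homotopic_sym; apply: homotopic_comp; first exact: cts_fun.
by apply: homotopic_comp h; exact: cts_fun.
Qed.

Lemma pure_Gbraid_to_braidE (c : pure_Gbraid_group)
    (al : {path I from x to x in orbit_conf a n}) :
  val c = orbit_class xfree (loop_orbit_path al) ->
  pure_Gbraid_to_braid c = pi1_class (embed_loop al).
Proof.
move=> cal; apply: xget_unique; first by exists al.
move=> b [be [+ ->]]; rewrite cal => /orbit_class_eqP h.
apply/pi1_eqP/homotopic_sym; apply: homotopic_comp h; exact: cts_fun.
Qed.

End Gbraids.

Definition short_exact (A B C : groupType) (f : A -> B) (g : B -> C) :=
  [/\ {morph f : u v / (u * v)%g} /\ {morph g : u v / (u * v)%g},
      injective f,
      (forall b, g b = 1%g <-> exists u, f u = b) &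
      forall c, exists b, g b = c].

Arguments pure_braid_incl R {M n} y c.
Arguments braid_perm R {M n} y c.
Arguments pure_Gbraid_incl R {G M a n x} xfree c.
Arguments Gbraid_perm R {G M a n x} xfree c.
Arguments pure_Gbraid_to_braid R {G M a n x} xfree c.
Arguments Gbraid_to_braid R {G M a n x} xfree c.

(* Main.v *)
Require Import Defs.
From mathcomp Require Import all_boot all_order all_algebra all_fingroup.
From mathcomp Require Import generic_quotient ring lra.
From mathcomp Require Import all_classical reals topology normedtype sequences homotopy.
Local Open Scope classical_set_scope.

(* Inside F(M, n), the complement of F_G(M, n) is the union of the finitely many
   graphs {y_i = g y_j}, each of codimension m >= 2, so a path of F(M, n) with
   ends in F_G(M, n) can be pushed off them: cover it by products of disjoint
   Euclidean balls, in which any two paths with the same ends are homotopic, and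
   join points of F_G(M, n) inside such a product by moving one coordinate at a
   time in a ball minus finitely many points.
   The lower row is exact because F(M, n) -> F(M, n) / Sigma_n is a covering. *)

Set Implicit Arguments.
Unset Strict Implicit.
Unset Printing Implicit Defensive.

Import Order.TTheory GRing.Theory Num.Theory.
Import numFieldNormedType.Exports.

Local Open Scope ring_scope.

(** * Connectedness and paths *)

(** Fixing all coordinates but one replaces it by something elementary: a single point of M has to
    avoid finitely many points, and in a chart broken lines with a perturbed vertex do this. The
    push has to be a homotopy with fixed ends, since surjectivity is about given classes; only its
    final path must lie in F_G(M, n), while the intermediate ones may cross the graphs. Compactness
    of the interval is never invoked: subdivision arguments are replaced by locally constant
    predicates on the connected line. *)

Lemma connected_locally_constant (T : topologicalType) (P : T -> Prop) :
  connected [set: T] -> (forall t, \forall u \near t, P t <-> P u) ->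
  forall t u, P t -> P u.
Proof.
move=> cT lP t u Pt.
have oP : open [set v | P v].
  rewrite openE => v Pv; rewrite /interior /=.
  by apply: filterS (lP v) => w [+ _]; exact.
have cP : closed [set v | P v].
  rewrite -openC openE => v nPv; rewrite /interior /=.
  by apply: filterS (lP v) => w [_ wv] /wv.
have := cT [set v | P v]; rewrite -[P u]/([set v | P v] u) => -> //.
- by exists t.
- by exists [set v | P v] => //; rewrite setTI.
- by exists [set v | P v] => //; rewrite setTI.
Qed.

Lemma real_connected (R : realType) : connected [set: R].
Proof. by apply/connected_intervalP => x y z. Qed.

(** Takes the place of a Lebesgue number: an additive property of intervals that holds for all short
    ones holds for all. *)
Lemma interval_induction (R : realType) (Q : R -> R -> Prop) :
  (forall a b c, a <= b -> b <= c -> Q a b -> Q b c -> Q a c) ->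
  (forall t, exists2 e, 0 < e &
     forall a b, t - e < a -> a <= b -> b < t + e -> Q a b) ->
  forall a b, a <= b -> Q a b.
Proof.
move=> Qadd Qloc a b ab.
(* Quantifying over all [c] up to [b] makes [D] vacuous to the left of [a], so that it is locally
   constant on the whole line. *)
pose D b := forall c, a <= c -> c <= b -> Q a c.
suff: D b by apply.
apply: (@connected_locally_constant _ D _ _ a).
- exact: real_connected.
- have h t e u v : (forall a b, t - e < a -> a <= b -> b < t + e -> Q a b) ->
    t - e < u -> u < t + e -> v < t + e -> D u -> D v.
    move=> Qt tu ut vt Du c ac cv.
    have [cu|uc] := leP c u; first exact: Du.
    have [au|ua] := leP a u; last by apply: Qt => //; lra.
    by apply: (Qadd a u c) => //; [exact: ltW|exact: Du|apply: Qt; lra].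
  move=> t; have [e e0 Qt] := Qloc t.
  apply: filterS (nbhsx_ballx t e e0) => u /=; rewrite /ball /= ltr_norml => /andP[u1 u2].
  by split; apply: (h t e) => //; lra.
- have [e e0 Qa] := Qloc a.
  by move=> c ac ca; apply: Qa; lra.
Qed.

Section joined.
Context {R : realType} {T : topologicalType}.
Local Notation I := (unit_interval R).

Definition joined (A : set T) (u v : T) := exists f : I -> T,
  [/\ continuous f, f zero = u, f one = v & forall s, A (f s)].

Lemma joined_refl (A : set T) u : A u -> joined A u u.
Proof. by move=> Au; exists (fun=> u); split => //; exact: cts_cst. Qed.

Lemma joined_sym (A : set T) u v : joined A u v -> joined A v u.
Proof.
move=> [f [cf f0 f1 fA]]; exists (path_rev f).
by rewrite path_rev0 path_rev1; split => //; [exact: path_rev_continuous|move=> s; exact: fA].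
Qed.

Lemma concat_in (A : set T) (f g : I -> T) :
  (forall s, A (f s)) -> (forall s, A (g s)) -> forall s, A (concat f g s).
Proof. by move=> fA gA s; rewrite /concat; case: ifP. Qed.

Lemma joined_trans (A : set T) u v w : joined A u v -> joined A v w -> joined A u w.
Proof.
move=> [f [cf f0 f1 fA]] [g [cg g0 g1 gA]]; exists (concat f g).
rewrite concat0 concat1; split=> //; last exact: concat_in.
by apply: concat_continuous => //; rewrite f1.
Qed.

Lemma joined_sub (A B : set T) u v : A `<=` B -> joined A u v -> joined B u v.
Proof. by move=> AB [f [cf f0 f1 fA]]; exists f; split=> // s; exact: AB. Qed.

End joined.

(** * Pushing paths into a subset *)

Section segments.
Context {R : realType} {T : topologicalType}.
Local Notation I := (unit_interval R).

Lemma homotopic_reparamR (f : R -> T) (a b : I -> R) :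
  continuous f -> continuous a -> continuous b ->
  a zero = b zero -> a one = b one -> homotopic_rel (f \o a) (f \o b).
Proof.
move=> cf ca cb ab0 ab1.
exists (fun p => f ((1 - ival p.2) * a p.1 + ival p.2 * b p.1)); split => /=.
- apply: cts_comp cf; apply: ctsD; apply: ctsM.
  + by apply: ctsB; [exact: cts_cst|exact: cts_ival cts_snd].
  + by apply: cts_comp ca; exact: cts_fst.
  + exact: cts_ival cts_snd.
  + by apply: cts_comp cb; exact: cts_fst.
- by move=> s; rewrite ival0 subr0 mul1r mul0r addr0.
- by move=> s; rewrite ival1 subrr mul1r mul0r add0r.
- by move=> t; rewrite ab0 -mulrDl subrK mul1r.
- by move=> t; rewrite ab1 -mulrDl subrK mul1r.
Qed.

(** The path is defined on the whole line, and [b < a] is allowed: the segment is then run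
    backwards. *)
Definition seg (f : R -> T) (a b : R) (s : I) : T := f (a + ival s * (b - a)).

Lemma seg0 f a b : seg f a b zero = f a.
Proof. by rewrite /seg ival0 mul0r addr0. Qed.

Lemma seg1 f a b : seg f a b one = f b.
Proof. by rewrite /seg ival1 mul1r addrC subrK. Qed.

Lemma affine_continuous a b : continuous (fun s : I => a + ival s * (b - a)).
Proof.
by apply: ctsD; [exact: cts_cst|apply: ctsM; [exact: cts_ival cts_id|exact: cts_cst]].
Qed.

Lemma seg_continuous f a b : continuous f -> continuous (seg f a b).
Proof. by move=> cf; apply: cts_comp cf; exact: affine_continuous. Qed.

(** Both sides are [f] after maps into the line with the same ends, so the order of [a], [b], [c]
    does not matter. *)
Lemma seg_concat f a b c : continuous f ->
  homotopic_rel (concat (seg f a b) (seg f b c)) (seg f a c).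
Proof.
move=> cf; rewrite -[seg f a b]/(f \o fun s : I => a + ival s * (b - a)).
rewrite -[seg f b c]/(f \o fun s : I => b + ival s * (c - b)) -comp_concat.
apply: homotopic_reparamR => //.
- apply: concat_continuous; try exact: affine_continuous.
  by rewrite ival1 ival0; ring.
- exact: affine_continuous.
- by rewrite concat0 ival0; ring.
- by rewrite concat1 ival1; ring.
Qed.

End segments.

Section push.
Context {R : realType} {T : topologicalType} (A : set T) (B : set (set T)).
Local Notation I := (unit_interval R).

Hypothesis B_open : forall U, B U -> open U.
Hypothesis B_homotopic : forall U (f g : I -> T), B U ->
  continuous f -> continuous g -> (forall s, U (f s)) -> (forall s, U (g s)) ->
  f zero = g zero -> f one = g one -> homotopic_rel f g.
Hypothesis B_joined : forall U u v, B U -> (U `&` A) u -> (U `&` A) v ->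
  joined (R := R) (U `&` A) u v.
Hypothesis B_basis : forall p N, nbhs p N -> exists U, [/\ B U, U p & U `<=` N].
Hypothesis B_dense : forall U p, B U -> U p -> exists2 v, A v & joined (R := R) U p v.

(* Up to a short path [d] inside [U], the initial part of [f] can be pushed into
   [A]. *)
Let pushed (f : R -> T) (t : R) := forall U, B U -> U (f t) ->
  exists v (d q : I -> T),
    [/\ [/\ continuous d, d zero = f t, d one = v & forall s, U (d s)],
        [/\ continuous q, q zero = f 0, q one = v & forall s, A (q s)] &
        homotopic_rel (concat (seg f 0 t) d) q].

(** Two routes inside [W] lead from [f t] to a point [v'] of [A] near [f u]: along [f] and then
    [d'], or along the old detour [d] and then [r] in [A]. They are homotopic because [W] is in [B],
    so [r] can be appended to [q]. *)
Let pushed_step f W t u : continuous f -> B W ->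
  (forall s : I, W (f (t + ival s * (u - t)))) -> pushed f t -> pushed f u.
Proof.
move=> cf BW fW pt U BU Uu.
have Wt : W (f t) by have := fW zero; rewrite ival0 mul0r addr0.
have Wu : W (f u) by have := fW one; rewrite ival1 mul1r addrC subrK.
(* As [pushed] speaks of every [U] around the point, the old detour may be taken in [W]; the new one
   is taken in [U] and [W] at once. *)
have [v [d [q [[cd d0 d1 dW] [cq q0 q1 qA] dq]]]] := pt W BW Wt.
have nUW : nbhs (f u) (U `&` W).
  by apply: open_nbhs_nbhs; split => //; apply: openI; exact: B_open.
have [V [BV Vu VUW]] := B_basis nUW.
have [v' Av' [d' [cd' d'0 d'1 d'V]]] := B_dense BV Vu.
have Wv : (W `&` A) v by split; [rewrite -d1|rewrite -q1].
have Wv' : (W `&` A) v' by split=> //; rewrite -d'1; apply: (VUW _ _).2.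
have [r [cr r0 r1 rWA]] := B_joined BW Wv Wv'.
exists v', d', (concat q r); split.
- by split=> // s; apply: (VUW _ _).1.
- rewrite concat0 concat1; split=> //.
    by apply: concat_continuous => //; rewrite q1.
  by apply: concat_in => // s; case: (rWA s).
have cs a b : continuous (seg f a b : I -> T) by exact: seg_continuous.
have hd : homotopic_rel (concat (seg f t u) d') (concat d r).
  apply: (B_homotopic BW).
  - by apply: concat_continuous => //; rewrite seg1.
  - by apply: concat_continuous => //; rewrite d1.
  - by apply: concat_in => s; [exact: fW|apply: (VUW _ _).2].
  - by apply: concat_in => s; [exact: dW|case: (rWA s)].
  - by rewrite !concat0 seg0.
  - by rewrite !concat1 d'1.
apply: (homotopic_trans (g := concat (concat (seg f 0 t) (seg f t u)) d')).
  apply: homotopic_concat; first by rewrite seg1.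
    by apply: homotopic_sym; exact: seg_concat.
  exact: homotopic_refl.
apply: (homotopic_trans (g := concat (seg f 0 t) (concat (seg f t u) d'))).
  by apply: homotopic_concatA => //; rewrite ?seg1 ?seg0.
apply: (homotopic_trans (g := concat (seg f 0 t) (concat d r))).
  apply: homotopic_concat => //; first by rewrite concat0 seg0 seg1.
  exact: homotopic_refl.
apply: (homotopic_trans (g := concat (concat (seg f 0 t) d) r)).
  by apply: homotopic_sym; apply: homotopic_concatA => //; rewrite ?seg1 ?d1.
apply: homotopic_concat => //; first by rewrite concat1 d1.
exact: homotopic_refl.
Qed.

(** The basis [B] is abstract because the lemma serves twice: for M minus finitely many points, with
    cells, and for F_G(M, n) in F(M, n), with products of disjoint cells. *)
Lemma homotopic_push (f : I -> T) : continuous f -> A (f zero) -> A (f one) ->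
  exists g : I -> T, [/\ continuous g, forall s, A (g s) & homotopic_rel f g].
Proof.
move=> cf A0 A1; pose F := f \o @clamp R.
have cF : continuous F by apply: cts_comp cf; exact: clamp_continuous.
have F0 : F 0 = f zero by [].
have F1 : F 1 = f one by [].
have p0 : pushed F 0.
  move=> U BU U0; exists (F 0), (fun=> F 0), (fun=> F 0); split.
  - by split=> //; exact: cts_cst.
  - by split=> //; exact: cts_cst.
  rewrite [seg _ _ _](_ : _ = fun=> F 0); last first.
    by apply/funext => s; rewrite /seg subrr mulr0 addr0.
  by apply: homotopic_concat1l; exact: cts_cst.
have : pushed F 1.
  apply: (@connected_locally_constant _ (pushed F) _ _ _ _ p0); first exact: real_connected.
  move=> t; have [W [BW Wt _]] := B_basis (p := F t) filterT.
  have : nbhs t (F @^-1` W).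
    by apply: cF; apply: open_nbhs_nbhs; split=> //; exact: B_open.
  move=> /nbhs_ballP[e /= e0 eW].
  apply: filterS (nbhsx_ballx t e e0) => u; rewrite /ball /= ltr_norml => /andP[u1 u2].
  have h (s : I) : 0 <= ival s <= 1 by exact: ival_itv.
  (* The step works in both directions along the line, which is what local constancy of [pushed F]
     requires. *)
  split; apply: (pushed_step cF BW) => s; apply: eW; rewrite /ball /= ltr_norml;
    have /andP[s0 s1] := h s; apply/andP; split; nra.
have [U [BU U1 _]] := B_basis (p := F 1) filterT.
move=> /(_ U BU U1)[v [d [q [[cd d0 d1 dU] [cq q0 q1 qA] dq]]]].
have Uv : (U `&` A) v by split; [rewrite -d1|rewrite -q1].
(* The end of [f] is itself in [A], so the last detour closes up: [d] followed by [r] is a loop in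
   [U], homotopic to the constant path. *)
have [r [cr r0 r1 rUA]] := B_joined BU Uv (conj U1 A1 : (U `&` A) (F 1)).
have fE : f = seg F 0 1.
  by apply/funext => s; rewrite /seg /F /= add0r subr0 mulr1 ivalK.
exists (concat q r); split.
- by apply: concat_continuous => //; rewrite q1.
- by apply: concat_in => // s; case: (rUA s).
rewrite -fE in dq.
apply: (homotopic_trans (g := concat f (fun=> f one))).
  by apply: homotopic_sym; exact: homotopic_concat1r.
apply: (homotopic_trans (g := concat f (concat d r))).
  apply: homotopic_concat => //; first exact: homotopic_refl.
  apply: (B_homotopic BU) => //.
  - exact: cts_cst.
  - by apply: concat_continuous => //; rewrite d1.
  - by apply: concat_in => s; [exact: dU|case: (rUA s)].
  - by rewrite concat0 d0.
  - by rewrite concat1 r1.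
apply: (homotopic_trans (g := concat (concat f d) r)).
  by apply: homotopic_sym; apply: homotopic_concatA => //; rewrite ?d0 ?d1.
apply: homotopic_concat => //; first by rewrite concat1 d1.
exact: homotopic_refl.
Qed.

End push.

(** * Euclidean cells *)

Lemma cts_coord {T : topologicalType} {k l : nat} (i : 'I_k) (j : 'I_l) :
  continuous (fun z : 'M[T]_(k, l) => z i j).
Proof.
move=> z N nN; rewrite nbhs_simpl /=.
exists (fun i' j' => if (i' == i) && (j' == j) then N else setT) => [i' j'|y /(_ i j)].
  by case: ifP => [/andP[/eqP-> /eqP->]//|_]; exact: filterT.
by rewrite !eqxx.
Qed.

Section cells.
Context {R : realType} {m : nat}.
Local Notation I := (unit_interval R).
Local Notation V := 'rV[R]_m.

Lemma cts_row {X : topologicalType} (h : X -> V) :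
  (forall i j, continuous (fun x => h x i j)) -> continuous h.
Proof.
move=> ch x N [P nP PN]; rewrite nbhs_simpl /=.
have : \forall y \near x, forall ij : 'I_1 * 'I_m, P ij.1 ij.2 (h y ij.1 ij.2).
  by apply: filter_forall => -[i j]; exact: ch (nP i j).
by apply: filterS => y hy; apply: PN => i j; exact: hy (i, j).
Qed.

Definition lerp (p q : V) (t : R) : V := p + t *: (q - p).

Lemma lerp0 p q : lerp p q 0 = p. Proof. by rewrite /lerp scale0r addr0. Qed.
Lemma lerp1 p q : lerp p q 1 = q. Proof. by rewrite /lerp scale1r addrC subrK. Qed.
Lemma lerpp p t : lerp p p t = p. Proof. by rewrite /lerp subrr scaler0 addr0. Qed.

Lemma cts_lerp {X : topologicalType} (p q : X -> V) (t : X -> R) :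
  continuous p -> continuous q -> continuous t ->
  continuous (fun x => lerp (p x) (q x) (t x)).
Proof.
move=> cp cq ct; apply: cts_row => i j.
rewrite (_ : (fun x => _) = fun x => p x i j + t x * (q x i j - p x i j)); last first.
  by apply/funext => x; rewrite /lerp !mxE.
have cpi : continuous (fun x => p x i j) by exact: (cts_comp cp (@cts_coord _ _ _ i j)).
have cqi : continuous (fun x => q x i j) by exact: (cts_comp cq (@cts_coord _ _ _ i j)).
by apply: ctsD => //; apply: ctsM => //; exact: ctsB.
Qed.

Definition convex (C : set V) :=
  forall p q t, C p -> C q -> 0 <= t <= 1 -> C (lerp p q t).

Lemma ball_convex (c : V) (r : R) : convex (ball c r).
Proof.
move=> p q t [r0 cp] [_ cq] /andP[t0 t1]; split=> // i j.
have := cp i j; have := cq i j; rewrite /ball /= !mxE.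
rewrite !ltr_norml => /andP[q1 q2] /andP[p1 p2].
have h (a b : R) : a < r -> b < r -> (1 - t) * a + t * b < r.
  (* A weight may vanish, so strictness is drawn from the term whose weight is at least one half. *)
  move=> ar br; have [tr|tr] := ltP t 2^-1; last by nra.
  have : t * b <= t * r by rewrite ler_wpM2l // ltW.
  have : (1 - t) * a < (1 - t) * r by rewrite ltr_pM2l //; lra.
  lra.
apply/andP; split.
  by have := h (p i j - c i j) (q i j - c i j); lra.
by have := h (c i j - p i j) (c i j - q i j); lra.
Qed.

Lemma ball_row_open (c : V) (r : R) : open (ball c r).
Proof.
rewrite openE => z [r0 cz]; exists (fun i j => ball (c i j) r) => [i j|y yP //].
by apply: open_nbhs_nbhs; split; [exact: ball_open|exact: cz].
Qed.

(** The perturbation parameters: an open condition holds for all large [k], and each point to be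
    avoided excludes at most one [k], so finitely many such demands are met together for large
    [k]. *)
Let tseq (k : nat) : R := k.+1%:R^-1.

Let tseq_inj : injective tseq.
Proof. by move=> k l /invr_inj/eqP; rewrite eqr_nat => /eqP[]. Qed.

Lemma near_line (C : set V) (p v : V) : open C -> C p ->
  \forall k \near \oo, C (p + k.+1%:R^-1 *: v).
Proof.
move=> oC Cp.
have cl : continuous (fun t : R => lerp p (p + v) t).
  by apply: cts_lerp; [exact: cts_cst|exact: cts_cst|exact: cts_id].
have : nbhs (0 : R) ((fun t => lerp p (p + v) t) @^-1` C).
  by apply: cl; rewrite lerp0; exact: open_nbhs_nbhs.
move=> /(@cvg_harmonic R) h.
have {}h : \forall k \near \oo, C (lerp p (p + v) (harmonic k)) by exact: h.
by apply: filterS h => k; rewrite /lerp addrAC subrr add0r.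
Qed.

(* The segments from [p] to the points of a sequence on a line missing [p] meet
   pairwise only in [p], so a given point lies on at most one of them. *)
Lemma near_segment_avoid (p s w : V) (i0 j0 : 'I_m) : w 0 i0 != 0 -> i0 != j0 ->
  s <> p -> \forall k \near \oo, forall t,
    lerp p (p + 2^-1 *: w + k.+1%:R^-1 *: delta_mx 0 j0) t <> s.
Proof.
move=> wi ij sp.
have [[k0 [t0 e0]]|nk] := pselect (exists k t,
    lerp p (p + 2^-1 *: w + k.+1%:R^-1 *: delta_mx 0 j0) t = s); last first.
  by near=> k => t e; apply: nk; exists k, t.
near=> k => t e.
have t_neq0 : t <> 0 by move=> t0'; apply: sp; rewrite -e t0' lerp0.
have /matrixP ee := etrans e (esym e0).
(* The coordinate [i0], untouched by the perturbation along [j0], determines [t]; since [t] is not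
   zero, the coordinate [j0] then determines [k]. *)
have := ee 0 i0; rewrite /lerp !mxE (negbTE ij) !andbF !mulr0 !addr0.
have -> (x y : R) : x + y - x = y by ring.
move=> /addrI ; rewrite !mulrA => /(mulIf wi) /(mulIf (_ : 2^-1 != 0)) tt.
have {}tt : t = t0 by apply: tt; rewrite invr_eq0 pnatr_eq0.
have := ee 0 j0; rewrite /lerp !mxE !eqxx -tt => /addrI/(mulfI (introN eqP t_neq0)).
move=> /addIr/addrI; rewrite !mulr1 => /tseq_inj kk0.
have : (k0 < k)%N by near: k; exact: nbhs_infty_gt.
by rewrite kk0 ltnn.
Unshelve. all: by end_near. Qed.

Context {M : topologicalType}.

(** The chart and its inverse are total functions with arbitrary values off [U] and [C]; continuity
    is asked at the points of these open sets only. *)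
Definition cell (U : set M) := exists (f : M -> V) (g : V -> M) (C : set V),
  [/\ open U, open C, convex C,
      forall u, U u -> [/\ C (f u), g (f u) = u & {for u, continuous f}] &
      forall z, C z -> [/\ U (g z), f (g z) = z & {for z, continuous g}]].

Lemma cell_open U : cell U -> open U.
Proof. by move=> [f [g [C []]]]. Qed.

Lemma cts_on {X Y Z : topologicalType} (h : X -> Y) (g : Y -> Z) (C : set Y) :
  continuous h -> (forall x, C (h x)) -> (forall z, C z -> {for z, continuous g}) ->
  continuous (g \o h).
Proof. by move=> ch hC cg x; apply: continuous_comp; [exact: ch|exact: cg]. Qed.

(** The straight-line homotopy in the chart. That it stays in [U] is recorded so that homotopies in
    disjoint cells combine into one in F(M, n). *)
Lemma cell_homotopic U (p q : I -> M) : cell U -> continuous p -> continuous q ->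
  (forall s, U (p s)) -> (forall s, U (q s)) ->
  p zero = q zero -> p one = q one ->
  exists H : I * I -> M,
  [/\ [/\ continuous H, forall s, H (s, zero) = p s & forall s, H (s, one) = q s],
      forall t, H (zero, t) = p zero, forall t, H (one, t) = p one &
      forall z, U (H z)].
Proof.
move=> [f [g [C [oU oC xC fU gC]]]] cp cq pU qU e0 e1.
pose h (z : I * I) : V := lerp (f (p z.1)) (f (q z.1)) (ival z.2).
have cf (r : I -> M) : continuous r -> (forall s, U (r s)) ->
    continuous (fun z : I * I => f (r z.1)).
  move=> cr rU; apply: (cts_comp (f := fun z : I * I => z.1) (g := f \o r)).
    exact: cts_fst.
  by apply: cts_on cr rU _ => u /fU[].
have hC z : C (h z).
  by apply: xC; [have [] := fU _ (pU z.1)|have [] := fU _ (qU z.1)|exact: ival_itv].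
exists (g \o h); split; last by move=> z; have [] := gC _ (hC z).
- split=> [|s|s] /=.
  + apply: (@cts_on _ _ _ h g C) => //; last by move=> z /gC[].
    by apply: cts_lerp; [exact: cf|exact: cf|exact: cts_ival cts_snd].
  + by rewrite /h ival0 lerp0; have [] := fU _ (pU s).
  + by rewrite /h ival1 lerp1; have [] := fU _ (qU s).
- by move=> t /=; rewrite /h /= -e0 lerpp; have [] := fU _ (pU zero).
- by move=> t /=; rewrite /h /= -e1 lerpp; have [] := fU _ (pU one).
Qed.

(** The form in which dimension at least 2 enters the general position arguments. It mentions no
    chart, so a connected M can itself be taken as [U]. *)
Definition robust (U : set M) := forall (J : finType) (b : J -> M),
  (exists2 p, U p & forall j, p <> b j) /\
  forall p q, U p -> (forall j, p <> b j) -> U q -> (forall j, q <> b j) ->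
    joined (R := R) [set z | U z /\ forall j, z <> b j] p q.

(** Two points are joined by a broken line in the chart whose vertex is a perturbed midpoint; on
    each half, a removed point rules out at most one perturbation. *)
Lemma cell_robust U p0 : (2 <= m)%N -> cell U -> U p0 -> robust U.
Proof.
move=> m2 [f [g [C [oU oC xC fU gC]]]] Up0 J b.
have fg u : U u -> g (f u) = u by move=> /fU[].
have Cf u : U u -> C (f u) by move=> /fU[].
have j0 : 'I_m by exact: Ordinal m2.
split.
  have [k [Ck nk]] : exists k, C (f p0 + k.+1%:R^-1 *: delta_mx 0 j0) /\
      forall j, f p0 + k.+1%:R^-1 *: delta_mx 0 j0 <> f (b j).
    near \oo => k; exists k; split; first by near: k; apply: near_line => //; exact: Cf.
    near: k; apply: filter_forall => j.
    have [[k0 e0]|nk] := pselect (exists k, f p0 + k.+1%:R^-1 *: delta_mx 0 j0 = f (b j)).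
      near=> k; rewrite -e0 => /addrI/matrixP/(_ 0 j0).
      rewrite !mxE !eqxx !mulr1 => /tseq_inj kk0.
      have : (k0 < k)%N by near: k; exact: nbhs_infty_gt.
      by rewrite kk0 ltnn.
    by near=> k => e; apply: nk; exists k.
  have [Ugk fgk _] := gC _ Ck.
  by exists (g (f p0 + k.+1%:R^-1 *: delta_mx 0 j0)) => // j e; apply: (nk j); rewrite -e.
move=> p q Up pb Uq qb.
have [pq|pq] := eqVneq (f p) (f q).
  by rewrite -(fg p Up) pq fg //; exact: joined_refl.
have [i0 wi0] : exists i0, (f q - f p) 0 i0 != 0.
  apply: contrapT => w0; move/eqP: pq; apply; apply/esym/eqP; rewrite -subr_eq0.
  apply/eqP/rowP => i; rewrite [RHS]mxE; apply: contrapT => /eqP wi.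
  by apply: w0; exists i.
(* The perturbation needs a direction other than [i0], along which the end points differ; here
   [2 <= m] is used. *)
have [j1 ij1] : exists j1, i0 != j1.
  have i1 : 'I_m by exact: Ordinal (ltnW m2).
  apply: contrapT => nj; have e j : j = i0.
    by apply: contrapT => /eqP ji; apply: nj; exists j; rewrite eq_sym.
  have := e (Ordinal (ltnW m2)); rewrite -(e (Ordinal m2)) => /(congr1 val).
  by [].
pose r k := f p + 2^-1 *: (f q - f p) + k.+1%:R^-1 *: delta_mx 0 j1.
(* The midpoint is symmetric in its ends, so the half starting at [q] has the same shape as the one
   starting at [p]. *)
have rE k : r k = f q + 2^-1 *: (f p - f q) + k.+1%:R^-1 *: delta_mx 0 j1.
  by rewrite /r; congr (_ + _); apply/rowP => i; rewrite !mxE; field.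
have [k [Ck pk qk]] : exists k, [/\ C (r k),
    forall j, U (b j) -> forall t, lerp (f p) (r k) t <> f (b j) &
    forall j, U (b j) -> forall t, lerp (f q) (r k) t <> f (b j)].
  near \oo => k; exists k; split; near: k.
  - apply: near_line => //.
    rewrite (_ : _ + _ = lerp (f p) (f q) 2^-1) //; apply: xC; [exact: Cf|exact: Cf|].
    by apply/andP; split; lra.
  (* A point [b j] outside [U] is missed by any path in [U], and its image under [f] means
     nothing. *)
  - apply: filter_forall => j; have [Ubj|nUbj] := pselect (U (b j)); last by near=> k.
    apply: filterS (near_segment_avoid wi0 ij1 _) => [l h _|]; first exact: h.
    by move=> e; apply: (pb j); rewrite -[p]fg // -e fg.
  - apply: filter_forall => j; have [Ubj|nUbj] := pselect (U (b j)); last by near=> k.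
    have wi1 : (f p - f q) 0 i0 != 0 by rewrite -opprB mxE oppr_eq0.
    apply: filterS (near_segment_avoid wi1 ij1 _) => [l h _ t|]; first by rewrite rE; exact: h.
    by move=> e; apply: (qb j); rewrite -[q]fg // -e fg.
have half u : U u -> (forall j, U (b j) -> forall t, lerp (f u) (r k) t <> f (b j)) ->
    joined (R := R) [set z | U z /\ forall j, z <> b j] u (g (r k)).
  move=> Uu ub.
  have lC (s : I) : C (lerp (f u) (r k) (ival s)).
    by apply: xC Ck (ival_itv s); exact: Cf.
  exists (g \o fun s : I => lerp (f u) (r k) (ival s)); split => /=.
  - apply: (@cts_on _ _ _ _ g C) => //; last by move=> z /gC[].
    by apply: cts_lerp; [exact: cts_cst|exact: cts_cst|exact: cts_ival cts_id].
  - by rewrite ival0 lerp0 fg.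
  - by rewrite ival1 lerp1.
  - move=> s; have [Us fs _] := gC _ (lC s); split=> // j e.
    by apply: (ub j _ (ival s)); rewrite -e.
by apply: joined_trans (half p Up pk) (joined_sym (half q Uq qk)).
Unshelve. all: by end_near. Qed.

Lemma cell_basis (p : M) N : topological_manifold R m M -> nbhs p N ->
  exists U, [/\ cell U, U p & U `<=` N].
Proof.
move=> [_ _ /(_ p)[W [f [g [[oW Wp] ofW cf cg fgK]]]]] nN.
have fK u : W u -> g (f u) = u by move=> Wu; apply: fgK; rewrite inE.
rewrite continuous_open_subspace // in cf; rewrite continuous_open_subspace // in cg.
have nC : nbhs (f p) ((f @` W) `&` g @^-1` N).
  apply: filterI; first by apply: open_nbhs_nbhs; split=> //; exists p.
  have cgp : {for f p, continuous g} by apply: cg; rewrite inE; exists p.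
  by apply: cgp; rewrite fK.
have /nbhs_ballP[e /= e0 eC] := nC.
pose C := ball (f p) e.
exists (W `&` f @^-1` C); split.
- exists f, g, C; split.
  + rewrite openE => u [Wu Cu]; apply: filterI; first exact: open_nbhs_nbhs.
    have cfu : {for u, continuous f} by apply: cf; rewrite inE.
    by apply: cfu; apply: open_nbhs_nbhs; split=> //; exact: ball_row_open.
  + exact: ball_row_open.
  + exact: ball_convex.
  + by move=> u [Wu Cu]; split=> //; [exact: fK|apply: cf; rewrite inE].
  + move=> z Cz; have [[u Wu uz] Nz] := eC _ Cz.
    have gz : g z = u by rewrite -uz fK.
    rewrite gz uz; split=> //; first by split=> //=; rewrite uz.
    by apply: cg; rewrite inE; exists u.
- by split=> //; exact: ballxx.
- move=> u [Wu Cu]; have [_ /=] := eC _ Cu.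
  by rewrite fK.
Qed.

End cells.

(** * General position in products *)

Section manifold.
Context {R : realType} {m : nat} {M : topologicalType}.
Hypotheses (M_manifold : topological_manifold R m M) (m_ge2 : (2 <= m)%N).
Local Notation I := (unit_interval R).
Local Notation cell := (@cell R m M).
Local Notation robust := (@robust R M).

Lemma cell_homotopic_rel U (p q : I -> M) : cell U -> continuous p -> continuous q ->
  (forall s, U (p s)) -> (forall s, U (q s)) ->
  p zero = q zero -> p one = q one -> homotopic_rel p q.
Proof.
move=> cU cp cq pU qU e0 e1.
have [H [[cH H0 H1] Hz Ho _]] := cell_homotopic cU cp cq pU qU e0 e1.
by exists H.
Qed.

Lemma robust_joined U p q : robust U -> U p -> U q -> joined (R := R) U p q.
Proof.
move=> rU Up Uq; have [_ /(_ p q Up _ Uq)h] := rU void (fun v => match v with end).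
by apply: joined_sub (h _ _) => [z []|[]|[]].
Qed.

(** Connectedness gives a path because cells are path connected; the path is then pushed off the
    finite set with [homotopic_push]. *)
Lemma manifold_robust (p0 : M) : connected [set: M] -> robust [set: M].
Proof.
move=> cM J b; split.
  have [U [cU Up _]] := cell_basis M_manifold (@filterT _ (nbhs p0) _).
  by have [[p _ pb] _] := cell_robust m_ge2 cU Up b; exists p.
move=> p q _ pb _ qb.
have [f [cf f0 f1 _]] : joined (R := R) setT p q.
  apply: (@connected_locally_constant _ (joined (R := R) setT p) cM _ p); last first.
    exact: joined_refl.
  move=> t; have [U [cU Ut _]] := cell_basis M_manifold (@filterT _ (nbhs t) _).
  have nU : nbhs t U by apply: open_nbhs_nbhs; split=> //; exact: cell_open cU.
  apply: filterS nU => u Uu.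
  have tu : joined (R := R) setT t u.
    exact: joined_sub (robust_joined (cell_robust m_ge2 cU Ut) Ut Uu).
  by split=> h; [exact: joined_trans h tu|exact: joined_trans h (joined_sym tu)].
have [g [cg gA fg]] : exists g : I -> M, [/\ continuous g,
    forall s, [set z | forall j, z <> b j] (g s) & homotopic_rel f g].
  apply: (homotopic_push (B := cell)) => //.
  - exact: cell_open.
  - exact: cell_homotopic_rel.
  - move=> U u v cU [Uu ub] [Uv vb].
    by have [_ h] := cell_robust m_ge2 cU Uu b; exact: h.
  - by move=> z N; exact: cell_basis.
  - move=> U z cU Uz; have rU := cell_robust m_ge2 cU Uz.
    have [[v Uv vb] _] := rU _ b.
    by exists v => //; exact: robust_joined.
  - by rewrite f0.
  - by rewrite f1.
have [e0 e1] := homotopic_ends fg.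
by exists g; split; rewrite -?e0 -?e1 // => s; split; last exact: gA.
Qed.

Context {G : finGroupType} {n : nat} (a : continuous_action G M).
Implicit Types (U : 'I_n -> set M) (y : {ptws 'I_n -> M}).

(** With the other coordinates fixed, these are finitely many points that one coordinate has to
    avoid, which is the situation of [robust]. *)
Lemma orbit_confP y : orbit_conf a n y <-> forall i j g, i <> j -> y i <> a g (y j).
Proof.
split=> [yP i j g ij e|yP i j ij].
  have /seteqP[+ _] := yP i j ij; move=> /(_ (y i)); apply; split.
    exact: act_orbit_refl.
  by rewrite e; exact: act_orbit_act.
apply/seteqP; split=> // z [[g _ gz] [h _ hz]].
by apply: (yP i j (g^-1 * h)%g ij); rewrite cactM hz -gz cactK.
Qed.

Definition prod_set U : set {ptws 'I_n -> M} := [set y | forall i, U i (y i)].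

(** The coordinates are corrected one after the other, each avoiding the points [b j] and the
    translates of the other coordinates. *)
Lemma generic_point U (J : finType) (b : J -> M) : (forall i, robust (U i)) ->
  exists w, [/\ prod_set U w, forall i j, w i <> b j & orbit_conf a n w].
Proof.
move=> rU.
suff /(_ n)[w [Uw wb wG]] : forall k, exists w, [/\ prod_set U w, forall i j, w i <> b j &
    forall (i j : 'I_n) g, (i < k)%N -> (j < k)%N -> i <> j -> w i <> a g (w j)].
  by exists w; split=> //; apply/orbit_confP => i j g; exact: wG.
elim=> [|k [w [Uw wb wG]]].
  have /choice[w wP] : forall i, exists p, U i p /\ forall j, p <> b j.
    by move=> i; have [[p Up pb] _] := rU i J b; exists p.
  by exists w; split=> // i; [case: (wP i)|move=> j; case: (wP i)].
have [kn|nk] := ltnP k n; last first.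
  by exists w; split=> // i j g _ _; apply: wG; apply: leq_trans nk.
pose i0 := Ordinal kn.
have [[p Up pb] _] := rU i0 (J + G * 'I_n)%type
  (fun x => match x with inl j => b j | inr gj => a gj.1 (w gj.2) end).
exists (fun i => if i == i0 then p else w i); split.
- by move=> i /=; case: eqP => [->|].
- by move=> i j; case: eqP => _ //; exact: pb (inl j).
have small (i : 'I_n) : (i < k.+1)%N -> i <> i0 -> (i < k)%N.
  by rewrite ltnS leq_eqVlt => /orP[/eqP ik []|//]; exact: val_inj.
move=> i j g ik jk; case: eqP => ii0; case: eqP => ji0 ij.
- by case: ij; rewrite ii0.
- exact: pb (inr (g, j)).
- move=> e; apply: (pb (inr (g^-1, i)%g)).
  by rewrite /= e cactK.
- by apply: wG => //; exact: small.
Qed.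

(** Since [w] avoids all translates of [u], every hybrid with the first [k] coordinates of [w] and
    the others of [u] is in F_G(M, n), and consecutive hybrids differ in one coordinate. *)
Lemma move_coordinates U (u w : {ptws 'I_n -> M}) : (forall i, robust (U i)) ->
  (prod_set U `&` orbit_conf a n) u -> (prod_set U `&` orbit_conf a n) w ->
  (forall i j g, w i <> a g (u j)) ->
  joined (R := R) (prod_set U `&` orbit_conf a n) u w.
Proof.
move=> rU [Uu /orbit_confP uG] [Uw /orbit_confP wG] wu.
have uw i j g : u i <> a g (w j).
  by move=> e; apply: (wu j i g^-1%g); rewrite e cactK.
pose hyb k : {ptws 'I_n -> M} := fun i => if (i < k)%N then w i else u i.
have hybG k : (prod_set U `&` orbit_conf a n) (hyb k).
  split; first by move=> i; rewrite /hyb; case: ifP.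
  apply/orbit_confP => i j g ij; rewrite /hyb; case: ifP => _; case: ifP => _ //;
    [exact: wG|exact: uG].
suff /(_ n) : forall k, joined (R := R) (prod_set U `&` orbit_conf a n) u (hyb k).
  by congr joined; apply/funext => i; rewrite /hyb ltn_ord.
elim=> [|k IHk].
  rewrite [hyb 0%N](_ : _ = u); last exact/funext.
  by apply: joined_refl; split=> //; exact/orbit_confP.
apply: joined_trans IHk _.
have [kn|nk] := ltnP k n; last first.
  rewrite [hyb k.+1](_ : _ = hyb k); first exact: joined_refl (hybG k).
  apply/funext => i; rewrite /hyb ltnS leq_eqVlt.
  by rewrite (leq_trans (ltn_ord i) nk) orbT.
pose i0 := Ordinal kn.
have hE i : hyb k.+1 i = if i == i0 then w i0 else hyb k i.
  rewrite /hyb ltnS leq_eqVlt -val_eqE /=; case: eqP => //= ik.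
  by congr w; exact: val_inj.
have hi0 : hyb k i0 = u i0 by rewrite /hyb ltnn.
(* The index [i0] is left out: the moving coordinate starts on its own orbit. *)
have [_ h] := rU i0 (G * {j : 'I_n | j != i0})%type (fun gj => a gj.1 (hyb k (val gj.2))).
have [|[g [j /= ji]]||[g [j /= ji]]|f [cf f0 f1 fA]] := h (u i0) (w i0) => //.
- rewrite -hi0; have [_ /orbit_confP hG] := hybG k; apply: hG.
  by move=> e; rewrite e eqxx in ji.
- have [_ /orbit_confP hG] := hybG k.+1.
  have := hG i0 j g; rewrite !hE eqxx (negbTE ji) /=; apply.
  by move=> e; rewrite e eqxx in ji.
exists (fun s => fun i => if i == i0 then f s else hyb k i); split.
- apply: continuous_ptws => i; case: eqP => _ //; exact: cts_cst.
- by apply/funext => i; rewrite f0 -hi0; case: eqP => [->|].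
- by apply/funext => i; rewrite f1 hE.
move=> s; have [Us fs] := fA s; split.
  by move=> i /=; case: eqP => [->//|_]; have [+ _] := hybG k; exact.
apply/orbit_confP => i j g; case: eqP => [->|/eqP ii0]; case: eqP => [->|/eqP ji0] // ij.
- exact: (fs (g, exist _ j ji0)).
- move=> e; apply: (fs (g^-1, exist _ i ii0)%g) => /=.
  by rewrite e cactK.
- by have [_ /orbit_confP hG] := hybG k; exact: hG.
Qed.

Lemma orbit_conf_joined U (u v : {ptws 'I_n -> M}) : (forall i, robust (U i)) ->
  (prod_set U `&` orbit_conf a n) u -> (prod_set U `&` orbit_conf a n) v ->
  joined (R := R) (prod_set U `&` orbit_conf a n) u v.
Proof.
move=> rU Au Av.
(* [u] and [v] need not be in general position to each other, so the path goes through a [w] that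
   avoids the translates of both; the boolean selects which of them. *)
have [w [Uw wb wG]] := @generic_point U _ (fun x : bool * (G * 'I_n) =>
  a x.2.1 ((if x.1 then u else v) x.2.2)) rU.
apply: (@joined_trans _ _ _ _ w); last apply: joined_sym.
  by apply: move_coordinates => // i j g; exact: wb i (true, (g, j)).
by apply: move_coordinates => // i j g; exact: wb i (false, (g, j)).
Qed.

End manifold.

(** * Configuration spaces *)

(** Neighbourhoods of a row vector are given by boxes by definition; they are transported along the
    continuous map from rows to functions. *)
Lemma nbhs_ptws {n : nat} {T : topologicalType} (y : {ptws 'I_n -> T}) N : nbhs y N ->
  exists P : 'I_n -> set T, (forall i, nbhs (y i) (P i)) /\
    forall z : {ptws 'I_n -> T}, (forall i, P i (z i)) -> N z.
Proof.
pose phi (A : 'rV[T]_n) : {ptws 'I_n -> T} := fun i => A 0 i.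
have cphi : continuous phi by apply: continuous_ptws => i; exact: cts_coord.
have phiK z : phi (\row_i z i) = z by apply/funext => i; rewrite /phi mxE.
move=> nN; have : nbhs (\row_i y i) (phi @^-1` N) by apply: cphi; rewrite phiK.
move=> [P nP PN]; exists (P 0); split=> [i|z Pz].
  by have := nP 0 i; rewrite mxE.
by rewrite -(phiK z); apply: PN => i j; rewrite mxE ord1.
Qed.

Lemma nbhs_set_type {T : topologicalType} (A : set T) (y : A) N : nbhs y N ->
  exists2 P, nbhs (set_val y) P & forall z : A, P (set_val z) -> N z.
Proof.
rewrite nbhsE => -[B [[P oP PB] By] BN]; exists P.
  by exists P => //; split=> //; rewrite -[P _]/((set_val @^-1` P) y) PB.
by move=> z Pz; apply: BN; rewrite -PB.
Qed.

Section conf_topology.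
Context {M : topologicalType} {n : nat}.
Implicit Types (U : 'I_n -> set M).

Definition disjoint_family U := forall i j z, U i z -> U j z -> i = j.

Definition box U : set (conf M n) := [set y | prod_set U (set_val y)].

Lemma conf_coord_continuous (i : 'I_n) : continuous (fun y : conf M n => set_val y i).
Proof.
apply: (cts_comp (f := set_val) (g := fun y : {ptws 'I_n -> M} => y i)).
  exact: initial_continuous.
exact: continuous_ptws_proj.
Qed.

Lemma box_open U : (forall i, open (U i)) -> open (box U).
Proof.
move=> oU; rewrite openE => y Uy.
apply: (@filter_forall _ _ (fun i z => U i (set_val z i)) (nbhs y)) => i.
by apply: conf_coord_continuous; exact: open_nbhs_nbhs.
Qed.

Lemma conf_disjoint_nbhs (y : conf M n) : hausdorff_space M ->
  exists P : 'I_n -> set M, (forall i, nbhs (set_val y i) (P i)) /\ disjoint_family P.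
Proof.
rewrite open_hausdorff => hM.
have sep (ij : 'I_n * 'I_n) : exists AB : set M * set M,
    [/\ nbhs (set_val y ij.1) AB.1, nbhs (set_val y ij.2) AB.2 &
        forall z, AB.1 z -> AB.2 z -> ij.1 = ij.2].
  case: ij => i j /=; have [->|ij] := eqVneq i j.
    by exists (setT, setT); split=> //; exact: filterT.
  have /hM [[A B] /= [Ay By] [oA oB AB]] : set_val y i != set_val y j.
    have yP : conf M n (set_val y) by exact: set_valP.
    by apply/eqP; apply: yP; exact/eqP.
  exists (A, B); split=> /=.
  - by apply: open_nbhs_nbhs; split=> //; rewrite inE in Ay.
  - by apply: open_nbhs_nbhs; split=> //; rewrite inE in By.
  - by move=> z Az Bz; move/eqP/seteqP: AB => [+ _] => /(_ z (conj Az Bz)).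
have [AB ABP] := choice sep.
(* The separations chosen for (i, j) and for (j, i) are unrelated, so a point is put in its side of
   both. *)
exists (fun i => [set z | forall j, (AB (i, j)).1 z /\ (AB (j, i)).2 z]); split.
  move=> i; apply: filter_forall => j; apply: filterI.
    by have [] := ABP (i, j).
  by have [] := ABP (j, i).
move=> i j z /(_ j)[zA _] /(_ i)[_ zB].
by have [_ _] := ABP (i, j); apply; first exact: zA.
Qed.

Lemma disjoint_conf U (z : {ptws 'I_n -> M}) :
  disjoint_family U -> prod_set U z -> conf M n z.
Proof. by move=> dU Uz i j ij e; apply: ij; apply: (dU i j (z i)) => //; rewrite e. Qed.

Definition to_conf (z : {ptws 'I_n -> M}) (zP : conf M n z) : conf M n :=
  exist _ z (mem_set zP).

Lemma to_conf_continuous {X : topologicalType} (f : X -> {ptws 'I_n -> M})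
    (fP : forall x, conf M n (f x)) :
  continuous f -> continuous (fun x => to_conf (fP x)).
Proof. by move=> cf; apply: continuous_initial. Qed.

Lemma joined_conf {R : realType} (A : set {ptws 'I_n -> M}) (u v : conf M n) :
  A `<=` conf M n -> joined (R := R) A (set_val u) (set_val v) ->
  joined (R := R) (set_val @^-1` A) u v.
Proof.
move=> AM [f [cf f0 f1 fA]]; exists (fun s => to_conf (AM _ (fA s))).
by split=> //; [exact: to_conf_continuous|exact: val_inj|exact: val_inj].
Qed.

End conf_topology.

Section push_conf.
Context {R : realType} {m : nat} {M : topologicalType}.
Hypotheses (M_manifold : topological_manifold R m M) (m_ge2 : (2 <= m)%N).
Context {G : finGroupType} {n : nat} (a : continuous_action G M).
Local Notation I := (unit_interval R).

(** For disjoint [U i] the full product lies in F(M, n), so paths and homotopies may be built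
    coordinate by coordinate. *)
Definition conf_cells : set (set (conf M n)) := [set W | exists U,
  [/\ W = box U, disjoint_family U & forall i, @cell R m M (U i)]].

Lemma conf_cells_basis (y : conf M n) N : nbhs y N ->
  exists W, [/\ conf_cells W, W y & W `<=` N].
Proof.
move=> /nbhs_set_type[N' /nbhs_ptws[P [nP PN']] N'N].
have [Q [nQ dQ]] : exists Q : 'I_n -> set M,
    (forall i, nbhs (set_val y i) (Q i)) /\ disjoint_family Q.
  by apply: conf_disjoint_nbhs; case: M_manifold.
have /choice[U UP] i : exists U, [/\ @cell R m M U, U (set_val y i) & U `<=` P i `&` Q i].
  by apply: cell_basis => //; exact: filterI.
exists (box U); split.
- exists U; split=> // [i j z Ui Uj|i]; last by case: (UP i).
  by apply: (dQ i j z); [have [_ _ /(_ _ Ui)[]] := UP i|have [_ _ /(_ _ Uj)[]] := UP j].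
- by move=> i; case: (UP i).
- move=> z Uz; apply: N'N; apply: PN' => i.
  by have [_ _ /(_ _ (Uz i))[]] := UP i.
Qed.

Lemma conf_cells_homotopic W (f g : I -> conf M n) : conf_cells W ->
  continuous f -> continuous g -> (forall s, W (f s)) -> (forall s, W (g s)) ->
  f zero = g zero -> f one = g one -> homotopic_rel f g.
Proof.
move=> [U [-> dU cU]] cf cg fU gU e0 e1.
have cc (h : I -> conf M n) i : continuous h -> continuous (fun s => set_val (h s) i).
  move=> ch; apply: (cts_comp (f := h) (g := fun y : conf M n => set_val y i)) => //.
  exact: conf_coord_continuous.
have /choice[H HP] i := cell_homotopic (cU i) (cc f i cf) (cc g i cg)
  (fun s => fU s i) (fun s => gU s i) (congr1 (fun y : conf M n => set_val y i) e0)
  (congr1 (fun y : conf M n => set_val y i) e1).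
have HU z : prod_set U ((fun i => H i z) : {ptws 'I_n -> M}).
  by move=> i; have [_ _ _] := HP i; exact.
exists (fun z => to_conf (disjoint_conf dU (HU z))); split.
- apply: to_conf_continuous; apply: continuous_ptws => i.
  by have [[]] := HP i.
- by move=> s; apply: val_inj; apply/funext => i /=; have [[_ ->]] := HP i.
- by move=> s; apply: val_inj; apply/funext => i /=; have [[_ _ ->]] := HP i.
- by move=> s; apply: val_inj; apply/funext => i /=; have [_ ->] := HP i.
- by move=> s; apply: val_inj; apply/funext => i /=; have [_ _ ->] := HP i.
Qed.

Lemma homotopic_push_conf (f : I -> conf M n) : continuous f ->
  orbit_conf a n (set_val (f zero)) -> orbit_conf a n (set_val (f one)) ->
  exists g : I -> orbit_conf a n, continuous g /\ homotopic_rel f (@conf_embed _ _ a n \o g).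
Proof.
move=> cf f0 f1.
have rU W y : conf_cells W -> W y -> exists U, [/\ W = box U, disjoint_family U &
    forall i, @robust R M (U i)].
  move=> [U [-> dU cU]] Uy; exists U; split=> // i.
  exact: (cell_robust m_ge2 (cU i) (Uy i)).
have [g [cg gA fg]] : exists g : I -> conf M n, [/\ continuous g,
    forall s, (set_val @^-1` orbit_conf a n) (g s) & homotopic_rel f g].
  apply: (homotopic_push (B := conf_cells)) => //.
  - move=> _ [U [-> _ cU]]; apply: box_open => i; exact: cell_open (cU i).
  - exact: conf_cells_homotopic.
  - move=> W u v /[dup] cW /rU rW [/[dup] /rW [U [-> dU {}rU]] Uu uA] [Uv vA].
    have Usub : prod_set U `&` orbit_conf a n `<=` conf M n.
      by move=> z [Uz _]; exact: disjoint_conf dU Uz.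
    by apply: (joined_conf Usub); exact: orbit_conf_joined.
  - exact: conf_cells_basis.
  - move=> W y /[dup] cW /rU rW /[dup] /rW [U [-> dU {}rU]] Uy.
    have [w [Uw _ wG]] := generic_point a (fun v : void => match v with end) rU.
    exists (to_conf (disjoint_conf dU Uw)) => //.
    have /choice[h hP] i := robust_joined (rU i) (Uy i) (Uw i).
    apply: (joined_conf (A := prod_set U)) => [z|]; first exact: disjoint_conf.
    exists (fun s i => h i s); split.
    + by apply: continuous_ptws => i; case: (hP i).
    + by apply/funext => i; case: (hP i).
    + by apply/funext => i; case: (hP i).
    + by move=> s i; case: (hP i).
pose g' s : orbit_conf a n := exist _ (set_val (g s)) (mem_set (gA s)).
exists g'; split.
  apply: continuous_initial; apply: (cts_comp cg); exact: initial_continuous.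
by rewrite [_ \o _](_ : _ = g) //; apply/funext => s; exact: val_inj.
Qed.

(** Applied to [x] and its permutations, this yields surjectivity onto the symmetric group in both
    rows. *)
Lemma orbit_conf_path (u v : orbit_conf a n) : (0 < n)%N -> connected [set: M] ->
  exists f : I -> orbit_conf a n, [/\ continuous f, f zero = u & f one = v].
Proof.
move=> n0 cM; have rT (i : 'I_n) : @robust R M setT.
  exact: (manifold_robust M_manifold m_ge2 (set_val u (Ordinal n0)) cM).
have inA (w : orbit_conf a n) : (prod_set (fun=> setT) `&` orbit_conf a n) (set_val w).
  by split=> //; exact: set_valP.
have [f [cf f0 f1 fA]] := orbit_conf_joined (U := fun=> setT) rT (inA u) (inA v).
exists (fun s => exist _ (f s) (mem_set (fA s).2)); split; try exact: val_inj.
exact: continuous_initial.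
Qed.

End push_conf.

(** * The covering of unordered configurations *)

Section covering.
Context {M : topologicalType} {n : nat}.
Hypothesis hM : hausdorff_space M.
Local Notation C := (conf M n).
Local Notation q := (@conf_quot M n).

Lemma conf_perm_continuous s : continuous (@conf_perm M n s).
Proof.
apply: continuous_initial; apply: continuous_ptws => i.
by have := @conf_coord_continuous M n (s i); exact.
Qed.

Lemma conf_quotP (y z : C) : q y = q z <-> exists s, z = conf_perm s y.
Proof.
by split=> [/eqmodP/asboolP//|[s ->]]; rewrite conf_quot_perm.
Qed.

Lemma conf_perm_inj (y : C) s t : conf_perm s y = conf_perm t y -> s = t.
Proof.
move=> e; apply/permP => i; apply: contrapT => st.
have yP : conf M n (set_val y) by exact: set_valP.
exact: yP _ _ st (congr1 (fun z : C => set_val z i) e).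
Qed.

(** The translates of such a box under permutations are disjoint, so it is mapped injectively to the
    quotient. *)
Lemma box_perm (P : 'I_n -> set M) s (y : C) :
  disjoint_family P -> box P y -> box P (conf_perm s y) -> s = 1%g.
Proof.
move=> dP Py Psy; apply/permP => i; rewrite perm1.
exact: dP (Py (s i)) (Psy i).
Qed.

Lemma conf_box (y : C) :
  exists P : 'I_n -> set M, [/\ open (box P : set C), box P y & disjoint_family P].
Proof.
have [P [nP dP]] := conf_disjoint_nbhs y hM.
exists (fun i => (P i)°); split=> //.
- by apply: box_open => i; exact: open_interior.
- by move=> i j z Pi Pj; apply: (dP i j z); exact: interior_subset.
Qed.

(** The permutation relating two lifts at a point is unique and locally constant, because near [t]
    both [f] and the back-permuted [g] stay in one box. *)
Lemma lifts_deck {T : topologicalType} (f g : T -> C) (t0 : T) :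
  connected [set: T] -> continuous f -> continuous g ->
  (forall t, q (f t) = q (g t)) ->
  exists s, forall t, g t = conf_perm s (f t).
Proof.
move=> cT cf cg fg; have [s st0] := (conf_quotP _ _).1 (fg t0).
exists s => t; apply: (@connected_locally_constant _
  (fun t => g t = conf_perm s (f t)) cT _ t0) => // {}t.
have [r rt] := (conf_quotP _ _).1 (fg t).
have [P [oP Pft dP]] := conf_box (f t).
have nf : \forall u \near t, box P (f u) by apply: cf; exact: open_nbhs_nbhs.
have ng : \forall u \near t, box P (conf_perm r^-1 (g u)).
  apply: (cts_comp cg (@conf_perm_continuous r^-1%g)).
  by rewrite rt conf_permM mulVg conf_perm1; exact: open_nbhs_nbhs.
apply: filterS2 nf ng => u Pfu.
have [v vu] := (conf_quotP _ _).1 (fg u).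
rewrite vu conf_permM rt => /(box_perm dP Pfu)/(canRL (mulKVg _)).
by rewrite mulg1 => ->; split=> /conf_perm_inj ->.
Qed.

Lemma lifts_unique {T : topologicalType} (f g : T -> C) (t0 : T) :
  connected [set: T] -> continuous f -> continuous g ->
  (forall t, q (f t) = q (g t)) -> f t0 = g t0 -> f =1 g.
Proof.
move=> cT cf cg fg fg0; have [s st] := lifts_deck t0 cT cf cg fg.
have s1 : s = 1%g by apply: (@conf_perm_inj (f t0)); rewrite -st conf_perm1.
by move=> t; rewrite st s1 conf_perm1.
Qed.

Lemma conf_quot_open (A : set C) : open A -> open (q @` A).
Proof.
move=> oA; suff h : open (q @^-1` (q @` A)) by exact: h.
rewrite (_ : _ @^-1` _ = \bigcup_(s : 'S_n) (conf_perm s @^-1` A)).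
  apply: bigcup_open => s _; apply: open_comp => // y _; exact: conf_perm_continuous.
apply/seteqP; split=> [y [z Az /esym/conf_quotP[s zE]]|y [s _ Ay]].
  by exists s => //=; rewrite -zE.
by exists (conf_perm s y) => //; exact: conf_quot_perm.
Qed.

Lemma conf_quot_section (z : unordered_conf M n) :
  exists V (sec : unordered_conf M n -> C), [/\ open V, V z &
    forall w, V w -> q (sec w) = w /\ {for w, continuous sec}].
Proof.
have [y yz] : exists y, q y = z by exists (repr z); exact: reprK.
have [P [oP Py dP]] := conf_box y.
(* On the image of the box there is exactly one such point; elsewhere [y] is a default value about
   which nothing is claimed. *)
pose sec w := xget y [set x | box P x /\ q x = w].
have secE x : box P x -> sec (q x) = x.
  move=> Px; apply: xget_unique => // x' [Px' /esym/conf_quotP[s sx]].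
  by rewrite sx (box_perm (s := s) dP Px) ?conf_perm1 // -sx.
exists (q @` box P), sec; split.
- exact: conf_quot_open.
- by exists y.
move=> _ [x Px <-]; rewrite secE //; split=> // N; rewrite secE // => nN.
have nqN : nbhs (q x) (q @` (N° `&` box P)).
  apply: open_nbhs_nbhs; split; last by exists x.
  by apply: conf_quot_open; apply: openI => //; exact: open_interior.
rewrite nbhs_simpl /=; apply: filterS nqN => _ [x' [Nx' Px'] <-].
by rewrite /= secE //; exact: interior_subset.
Qed.

(** * Lifting of squares, paths and homotopies *)

Section square.
Context {R : realType}.
Local Notation I := (unit_interval R).

Let cl (a b s : R) : R := Num.max a (Num.min s b).

Let cl_itv a b s : a <= b -> a <= cl a b s <= b.
Proof. by move=> ab; rewrite /cl le_max lexx ge_max ab ge_min lexx orbT. Qed.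

Let cl_id a b s : a <= s -> s <= b -> cl a b s = s.
Proof. by move=> sa sb; rewrite /cl min_l // max_r. Qed.

Let cts_cl {X : topologicalType} a b (f : X -> R) :
  continuous f -> continuous (fun x => cl a b (f x)).
Proof.
move=> cf; have c : continuous (cl a b).
  move=> t; have c : {for t, continuous
      ((fun=> a : R^o) \max ((id : R -> R^o) \min (fun=> b : R^o)))}.
    apply: continuous_max; first exact: cst_continuous.
    by apply: continuous_min; [exact: cvg_id|exact: cst_continuous].
  exact: c.
exact: cts_comp cf c.
Qed.

(** The lift is a map on the whole plane and only the equation is restricted to the rectangle;
    pieces are extended by clamping with [cl], and no subspace topology is needed. *)
Definition lifts_on (h : R * R -> unordered_conf M n) (a b c d : R) :=
  exists2 K : R * R -> C, continuous K & forall s t,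
    a <= s <= b -> c <= t <= d -> q (K (s, t)) = h (s, t).

Lemma lifts_on_glue h a b c d e : a <= b -> b <= e -> c <= d ->
  lifts_on h a b c d -> lifts_on h b e c d -> lifts_on h a e c d.
Proof.
move=> ab be cd [K1 cK1 K1h] [K2 cK2 K2h].
have cK (K : R * R -> C) : continuous K -> continuous (fun t => K (b, cl c d t)).
  move=> cK; apply: cts_comp cK; apply: cts_pair; first exact: cts_cst.
  exact: cts_cl cts_id.
(* On the common edge the two lifts differ by one permutation, by which [K1] is corrected before
   pasting. *)
have [|s sE] := @lifts_deck _ _ _ 0 (@real_connected R) (cK K1 cK1) (cK K2 cK2).
  by move=> t; rewrite K1h ?K2h ?cl_itv ?lexx ?ab ?be.
exists (fun p => if p.1 <= b then conf_perm s (K1 (p.1, cl c d p.2))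
                 else K2 (p.1, cl c d p.2)).
  have cp : continuous (fun p : R * R => (p.1, cl c d p.2)).
    by apply: cts_pair; [exact: cts_fst|apply: cts_cl; exact: cts_snd].
  apply: continuous_paste.
  - exact: cts_fst.
  - exact: cts_cst.
  - by apply: cts_comp (@conf_perm_continuous s); exact: cts_comp cp cK1.
  - exact: cts_comp cp cK2.
  - by move=> p ->; rewrite sE.
move=> u t /andP[au ue] tcd; have [ct td] := andP tcd; rewrite /= cl_id //.
by case: leP => [ub|/ltW bu]; rewrite ?conf_quot_perm ?K1h ?K2h ?au ?ub ?bu.
Qed.

Lemma lifts_on_swap h a b c d :
  lifts_on (fun p => h (p.2, p.1)) c d a b -> lifts_on h a b c d.
Proof.
move=> [K cK Kh]; exists (fun p => K (p.2, p.1)) => [|s t sab tcd].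
  by apply: cts_comp cK; apply: cts_pair; [exact: cts_snd|exact: cts_fst].
exact: Kh.
Qed.

Lemma lifts_on_local h s t : continuous h -> exists2 e, 0 < e & forall a b c d,
  s - e < a -> a <= b -> b < s + e -> t - e < c -> c <= d -> d < t + e ->
  lifts_on h a b c d.
Proof.
move=> ch; have [V [sec [oV Vst secV]]] := conf_quot_section (h (s, t)).
have : nbhs (s, t) (h @^-1` V) by apply: ch; exact: open_nbhs_nbhs.
move=> /nbhs_ballP[e /= e0 eV]; exists e => // a b c d sa ab bs tc cd dt.
pose k (p : R * R) := h (cl a b p.1, cl c d p.2).
have kV p : V (k p).
  apply: eV; have /andP[? ?] := cl_itv p.1 ab; have /andP[? ?] := cl_itv p.2 cd.
  by split; rewrite /ball /= ltr_norml; apply/andP; split; lra.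
have ck : continuous k.
  apply: cts_comp ch; apply: cts_pair; apply: cts_cl; [exact: cts_fst|exact: cts_snd].
exists (sec \o k).
  by apply: (@cts_on _ _ _ k sec V) => // z /secV[].
move=> u v /andP[? ?] /andP[? ?] /=; have [-> _] := secV _ (kV (u, v)).
by rewrite /k !cl_id.
Qed.

Lemma lifts_on_square h : continuous h -> lifts_on h 0 1 0 1.
Proof.
move=> ch; apply: (@interval_induction R (lifts_on h 0 1)) => //.
  move=> a b c ab bc Qab Qbc; apply: lifts_on_swap.
  by apply: (@lifts_on_glue _ a b) => //; exact: lifts_on_swap.
(* The inner induction carries a strip width around [t], reduced to a minimum at each gluing; this
   produces a strip of positive width over the whole of [0, 1]. *)
move=> t; apply: (@interval_induction R (fun a b => exists2 e, 0 < e & forall c d,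
    t - e < c -> c <= d -> d < t + e -> lifts_on h a b c d) _ _ 0 1 ler01).
  move=> a b c ab bc [e1 e10 Q1] [e2 e20 Q2].
  exists (Num.min e1 e2); first by rewrite lt_min e10.
  move=> u v tu uv vt.
  have [m1 m2] : Num.min e1 e2 <= e1 /\ Num.min e1 e2 <= e2.
    by rewrite !ge_min !lexx orbT.
  by apply: (lifts_on_glue ab bc uv); [apply: Q1|apply: Q2] => //; lra.
move=> s; have [e e0 Q] := lifts_on_local s t ch.
exists e => // a b sa ab bs; exists e => // c d tc cd dt.
exact: Q.
Qed.

Lemma interval_connected : connected [set: I].
Proof.
rewrite (_ : setT = @clamp R @` setT).
  apply: connected_continuous_connected; first exact: real_connected.
  by apply: continuous_subspaceT; exact: clamp_continuous.
by apply/seteqP; split=> // s _; exists (ival s) => //; exact: ivalK.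
Qed.

Lemma square_lift (H : I * I -> unordered_conf M n) (y : C) :
  continuous H -> q y = H (zero, zero) ->
  exists K : I * I -> C, [/\ continuous K, forall z, q (K z) = H z & K (zero, zero) = y].
Proof.
move=> cH yH.
have [|K cK KH] := @lifts_on_square (fun p => H (clamp p.1, clamp p.2)).
  apply: cts_comp cH; apply: cts_pair; apply: cts_clamp; [exact: cts_fst|exact: cts_snd].
have KH' (z : I * I) : q (K (ival z.1, ival z.2)) = H z.
  by rewrite KH ?ival_itv // !ivalK; case: z.
have [s sE] : exists s, y = conf_perm s (K (ival zero, ival zero)).
  by apply/conf_quotP; rewrite yH (KH' (zero, zero)).
exists (fun z => conf_perm s (K (ival z.1, ival z.2))); split=> //.
  apply: cts_comp (@conf_perm_continuous s); apply: cts_comp cK.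
  by apply: cts_pair; apply: cts_ival; [exact: cts_fst|exact: cts_snd].
by move=> z; rewrite conf_quot_perm.
Qed.

Lemma path_lift (g : I -> unordered_conf M n) (y : C) : continuous g -> q y = g zero ->
  exists f : I -> C, [/\ continuous f, f zero = y & forall s, q (f s) = g s].
Proof.
move=> cg yg.
have [|//|K [cK KH K0]] := @square_lift (fun z => g z.1) y.
  by apply: cts_comp cg; exact: cts_fst.
exists (fun s => K (s, zero)); split=> //.
by apply: cts_comp cK; apply: cts_pair; [exact: cts_id|exact: cts_cst].
Qed.

Lemma homotopic_lift (f g : I -> C) : continuous f -> continuous g ->
  f zero = g zero -> homotopic_rel (q \o f) (q \o g) -> homotopic_rel f g.
Proof.
move=> cf cg fg0 [H [cH H0 H1 Hz Ho]].
have [|K [cK KH K0]] := @square_lift H (f zero) cH; first by rewrite H0.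
have c1 (t : I) : continuous (fun s => K (s, t)).
  by apply: cts_comp cK; apply: cts_pair; [exact: cts_id|exact: cts_cst].
have c2 (s : I) : continuous (fun t => K (s, t)).
  by apply: cts_comp cK; apply: cts_pair; [exact: cts_cst|exact: cts_id].
(* Constancy on this edge gives the starting point for comparing [K (s, one)] with [g]; likewise
   [Kf] gives the one for the edge [K (one, t)]. *)
have Kz : (fun t => K (zero, t)) =1 fun=> f zero.
  apply: (lifts_unique (t0 := zero)) => //; first exact: interval_connected.
    exact: cts_cst.
  by move=> t; rewrite KH Hz.
have Kf : (fun s => K (s, zero)) =1 f.
  apply: (lifts_unique (t0 := zero)) => //; first exact: interval_connected.
  by move=> s; rewrite KH H0.
exists K; split=> // [s|t].
- apply: (lifts_unique (f := fun s => K (s, one)) (t0 := zero)) => //.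
  + exact: interval_connected.
  + by move=> u; rewrite KH H1.
  + by rewrite -fg0; exact: Kz.
- apply: (lifts_unique (f := fun t => K (one, t)) (g := fun=> f one) (t0 := zero)) => //.
  + exact: interval_connected.
  + exact: cts_cst.
  + by move=> u; rewrite KH Ho.
Qed.

End square.
End covering.

(** * The two exact sequences *)

Section pi1_fun.
Context {R : realType} {T : topologicalType} {x : T}.
Local Notation I := (unit_interval R).

(** Lets classes be compared through the underlying functions, whatever continuity and end point
    proofs the paths carry. *)
Lemma pi1_funE (p q : {path I from x to x in T}) :
  (p : I -> T) = q -> pi1_class p = pi1_class q.
Proof. by move=> e; apply/pi1_eqP; rewrite e; apply: homotopic_refl; exact: cts_fun. Qed.

End pi1_fun.

Section orbit_side.
Local Open Scope group_scope.
Context {R : realType} {G : finGroupType} {M : topologicalType}.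
Context {a : continuous_action G M} {n : nat} {x : orbit_conf a n}.
Hypothesis xfree : forall i, free_type a (act_orbit a (set_val x i)).
Local Notation I := (unit_interval R).
Local Notation B := (Gbraid_group R xfree).
Local Notation P := (pure_Gbraid_group R xfree).
Local Notation opath s := {path I from x to orbit_conf_perm s x in orbit_conf a n}.

Lemma orbit_class_funE (p q : orbit_path R x) :
  (p : I -> orbit_conf a n) = q -> orbit_class xfree p = orbit_class xfree q.
Proof. by move=> e; apply/orbit_class_eqP; rewrite e; apply: homotopic_refl; exact: cts_fun. Qed.

Lemma Gbraid_rep (c : B) : exists s (al : opath s), val c = orbit_class xfree (perm_orbit_path al).
Proof. by case: c => c /= /asboolP. Qed.

Lemma pure_Gbraid_rep (c : P) : exists al : {path I from x to x in orbit_conf a n},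
  val c = orbit_class xfree (loop_orbit_path al).
Proof. by case: c => c /= /asboolP. Qed.

Lemma Gbraid_of_path s (al : opath s) :
  exists c : B, val c = orbit_class xfree (perm_orbit_path al).
Proof.
have h : mem_Gbraid (orbit_class xfree (perm_orbit_path al)) by apply/asboolP; exists s, al.
by exists (exist (fun c => is_true (_ c)) _ h).
Qed.

Lemma pure_Gbraid_of_loop (al : {path I from x to x in orbit_conf a n}) :
  exists c : P, val c = orbit_class xfree (loop_orbit_path al).
Proof.
have h : mem_pure_Gbraid (orbit_class xfree (loop_orbit_path al)) by apply/asboolP; exists al.
by exists (exist (fun c => is_true (_ c)) _ h).
Qed.

Lemma orbit_conf_perm_continuous s : continuous (@orbit_conf_perm _ _ a n s).
Proof.
rewrite (_ : orbit_conf_perm s = orbit_conf_twist 1 s).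
  exact: orbit_conf_twist_continuous.
by apply/funext => y; rewrite orbit_conf_twist1.
Qed.

Lemma perm_path_mul s t (al : opath s) (be : opath t) :
  exists ga : opath (s * t), (ga : I -> _) = concat al (orbit_conf_perm s \o be).
Proof.
have c : continuous (concat al (orbit_conf_perm s \o be)).
  apply: concat_continuous; first exact: cts_fun.
    by apply: cts_comp (@orbit_conf_perm_continuous s); exact: cts_fun.
  by rewrite path1 /= path0.
have c1 : concat al (orbit_conf_perm s \o be) one = orbit_conf_perm (s * t) x.
  by rewrite concat1 /= path1 -!orbit_conf_twist1 orbit_conf_twistM; congr orbit_conf_twist;
    apply/ffunP => i; rewrite !ffunE mulg1.
by exists (mk_path c (etrans (concat0 _ _) (path0 al)) c1).
Qed.

Lemma Gbraid_mul_path (c d : B) s t (al : opath s) (be : opath t) (ga : opath (s * t)) :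
  val c = orbit_class xfree (perm_orbit_path al) ->
  val d = orbit_class xfree (perm_orbit_path be) ->
  (ga : I -> _) = concat al (orbit_conf_perm s \o be) ->
  val (c * d) = orbit_class xfree (perm_orbit_path ga).
Proof.
move=> cE dE gaE; rewrite valM cE dE -orbit_classM; apply: orbit_class_funE.
rewrite /= /mk_path gaE /orbit_concat /=; congr concat.
by apply/funext => u /=; rewrite orbit_conf_twist1.
Qed.

Lemma loop_perm_path (al : {path I from x to x in orbit_conf a n}) :
  exists be : opath 1, (be : I -> _) = al.
Proof.
have e1 : al one = orbit_conf_perm 1 x by rewrite path1 -orbit_conf_twist1 orbit_conf_twist11.
by exists (mk_path (@cts_fun _ _ al) (path0 al) e1).
Qed.

(** The topology of M enters only through the assumed paths, which give surjectivity; everything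
    else is read off the end points of representatives. *)
Lemma short_exact_Gbraid : (forall s, exists al : I -> orbit_conf a n,
    [/\ continuous al, al zero = x & al one = orbit_conf_perm s x]) ->
  short_exact (pure_Gbraid_incl R xfree) (Gbraid_perm R xfree).
Proof.
move=> px; split.
- split=> c d; first by apply: val_inj; rewrite [RHS]valM; exact: (valM (c : P)).
  have [s [al cE]] := Gbraid_rep c; have [t [be dE]] := Gbraid_rep d.
  have [ga gaE] := perm_path_mul al be.
  by rewrite (Gbraid_permE cE) (Gbraid_permE dE) (Gbraid_permE (Gbraid_mul_path cE dE gaE)).
- by move=> c d /(congr1 val) /= e; exact: val_inj.
- move=> c; split=> [|[d <-]].
    have [s [al cE]] := Gbraid_rep c; rewrite (Gbraid_permE cE) => s1.
    have mc : mem_pure_Gbraid (val c) by rewrite cE; apply/mem_pure_GbraidP.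
    by exists (exist (fun c => is_true (_ c)) _ mc); exact: val_inj.
  have [al dE] := pure_Gbraid_rep d; have [be beE] := loop_perm_path al.
  by apply: (Gbraid_permE (al := be)); rewrite /= dE; apply: orbit_class_funE.
- move=> s; have [al [cal al0 al1]] := px s.
  have [c cE] := Gbraid_of_path (mk_path cal al0 al1).
  by exists c; exact: Gbraid_permE cE.
Qed.

Lemma Gbraid_to_braidM : {morph Gbraid_to_braid R xfree : c d / c * d}.
Proof.
move=> c d; have [s [al cE]] := Gbraid_rep c; have [t [be dE]] := Gbraid_rep d.
have [ga gaE] := perm_path_mul al be.
rewrite (Gbraid_to_braidE cE) (Gbraid_to_braidE dE).
rewrite (Gbraid_to_braidE (Gbraid_mul_path cE dE gaE)).
rewrite -[RHS]pi1_classM; apply: pi1_funE => /=.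
rewrite /mk_path gaE -[LHS]/((@conf_quot M n \o @conf_embed _ _ a n) \o _) comp_concat.
(* The permutation twisting the second path disappears in the quotient, leaving the plain product of
   loops. *)
by congr concat; apply/funext => u /=; rewrite conf_embed_perm conf_quot_perm.
Qed.

Lemma pure_Gbraid_to_braidM : {morph pure_Gbraid_to_braid R xfree : c d / c * d}.
Proof.
move=> c d; have [al cE] := pure_Gbraid_rep c; have [be dE] := pure_Gbraid_rep d.
rewrite (pure_Gbraid_to_braidE cE) (pure_Gbraid_to_braidE dE).
have cdE : val (c * d) = orbit_class xfree (loop_orbit_path (path_concat al be)).
  rewrite valM cE dE -orbit_classM; apply: orbit_class_funE.
  rewrite /= /orbit_concat /=; congr concat.
  by apply/funext => u /=; rewrite orbit_conf_twist11.
rewrite (pure_Gbraid_to_braidE cdE) -[RHS]pi1_classM; apply: pi1_funE => /=.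
exact: comp_concat.
Qed.

Lemma Gbraid_to_braid_incl (c : P) :
  Gbraid_to_braid R xfree (pure_Gbraid_incl R xfree c) =
  pure_braid_incl R (conf_embed x) (pure_Gbraid_to_braid R xfree c).
Proof.
have [al cE] := pure_Gbraid_rep c; have [be beE] := loop_perm_path al.
rewrite (pure_Gbraid_to_braidE cE).
have incE : val (pure_Gbraid_incl R xfree c) = orbit_class xfree (perm_orbit_path be).
  by rewrite /= cE; apply: orbit_class_funE.
rewrite (Gbraid_to_braidE incE) [RHS]pi1_mapE; apply: pi1_funE => /=.
by rewrite /mk_path beE.
Qed.

End orbit_side.

Section braid_side.
Local Open Scope group_scope.
Context {R : realType} {M : topologicalType} {n : nat} {y : conf M n}.
Hypothesis hM : hausdorff_space M.
Local Notation I := (unit_interval R).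
Local Notation cpath s := {path I from y to conf_perm s y in conf M n}.

Lemma braid_rep (b : braid_group R y) : exists s (al : cpath s), b = pi1_class (quot_loop al).
Proof.
move: b; elim/pi1W => p.
have [|f [cf f0 fp]] := @path_lift _ _ hM R p y (@cts_fun _ _ p); first by rewrite (path0 p).
have [s f1] : exists s, f one = conf_perm s y.
  by apply/conf_quotP; rewrite fp path1.
by exists s, (mk_path cf f0 f1); apply: pi1_funE; apply/funext => u; exact: esym (fp u).
Qed.

(** Homotopies of loops lift, so all lifts from [y] of loops in one class have the same end, and
    that end determines the permutation. *)
Lemma braid_permE (b : braid_group R y) s (al : cpath s) :
  b = pi1_class (quot_loop al) -> braid_perm R y b = s.
Proof.
move=> ->; apply: xget_unique; first by exists al.
move=> t [be] /pi1_eqP h; apply: (@conf_perm_inj _ _ y); rewrite -(path1 al) -(path1 be).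
have [] // := @homotopic_ends _ _ al be; apply: homotopic_lift => //.
- exact: cts_fun.
- exact: cts_fun.
- by rewrite !path0.
Qed.

Lemma short_exact_braid : (forall s, exists al : I -> conf M n,
    [/\ continuous al, al zero = y & al one = conf_perm s y]) ->
  short_exact (pure_braid_incl R y) (braid_perm R y).
Proof.
move=> py; split.
- split=> c d; first exact: pi1_mapM.
  have [s [al cE]] := braid_rep c; have [t [be dE]] := braid_rep d.
  have cga : continuous (concat al (conf_perm s \o be)).
    apply: concat_continuous; first exact: cts_fun.
      by apply: cts_comp (@conf_perm_continuous _ _ s); exact: cts_fun.
    by rewrite path1 /= path0.
  have ga1 : concat al (conf_perm s \o be) one = conf_perm (s * t) y.
    by rewrite concat1 /= path1 conf_permM.
  rewrite (braid_permE cE) (braid_permE dE).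
  apply: (braid_permE (al := mk_path cga (etrans (concat0 _ _) (path0 al)) ga1)).
  rewrite cE dE -[LHS]pi1_classM; apply: pi1_funE => /=.
  by rewrite /mk_path comp_concat; congr concat; apply/funext => u /=; rewrite conf_quot_perm.
- elim/pi1W => p; elim/pi1W => r; rewrite /pure_braid_incl !pi1_mapE => /pi1_eqP h.
  apply/pi1_eqP; apply: homotopic_lift h => //; try exact: cts_fun.
  by rewrite !path0.
- move=> c; split=> [|[d <-]].
    have [s [al ->]] := braid_rep c; rewrite (braid_permE erefl) => s1.
    have al1 : al one = y by rewrite path1 s1 conf_perm1.
    exists (pi1_class (mk_path (@cts_fun _ _ al) (path0 al) al1)).
    by rewrite /pure_braid_incl pi1_mapE; apply: pi1_funE.
  move: d; elim/pi1W => p; rewrite /pure_braid_incl pi1_mapE.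
  have p1 : p one = conf_perm 1 y by rewrite path1 conf_perm1.
  apply: (braid_permE (al := mk_path (@cts_fun _ _ p) (path0 p) p1)).
  exact: pi1_funE.
- move=> s; have [al [cal al0 al1]] := py s.
  by exists (pi1_class (quot_loop (mk_path cal al0 al1))); exact: braid_permE.
Qed.

End braid_side.
Theorem proposition2p6 (R : realType) (m : nat) (M : topologicalType)
  (M_manifold : topological_manifold R m M)
  (M_dim : (2 <= m)%N)
  (M_connected : connected [set: M])
  (G : finGroupType) (a : continuous_action G M)
  (a_effective : effective a)
  (n : nat) (n_ge2 : (2 <= n)%N)
  (x : orbit_conf a n)
  (x_free : forall i : 'I_n, free_type a (act_orbit a (set_val x i))) :
  let y := conf_embed x in
  [/\ short_exact (pure_Gbraid_incl R x_free) (Gbraid_perm R x_free),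
      short_exact (pure_braid_incl R y) (braid_perm R y),
      [/\ {morph pure_Gbraid_to_braid R x_free : c d / (c * d)%g},
          {morph Gbraid_to_braid R x_free : c d / (c * d)%g},
          (forall c : pure_Gbraid_group R x_free,
             Gbraid_to_braid R x_free (pure_Gbraid_incl R x_free c) =
             pure_braid_incl R y (pure_Gbraid_to_braid R x_free c)) &
          (forall c : Gbraid_group R x_free,
             braid_perm R y (Gbraid_to_braid R x_free c) =
             Gbraid_perm R x_free c)],
      (forall b : pure_braid_group R y,
         exists c : pure_Gbraid_group R x_free,
           pure_Gbraid_to_braid R x_free c = b) &
      (forall b : braid_group R y,
         exists c : Gbraid_group R x_free,
           Gbraid_to_braid R x_free c = b)].
Proof.
have [hM _ _] := M_manifold; have n0 : (0 < n)%N by exact: ltnW.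
have px s := orbit_conf_path M_manifold M_dim x (orbit_conf_perm s x) n0 M_connected.
have embed_inj (u v : orbit_conf a n) : conf_embed u = conf_embed v -> u = v.
  by move=> /(congr1 (fun z : conf M n => set_val z)) /= e; exact: val_inj.
have inG (u : orbit_conf a n) : orbit_conf a n (set_val (conf_embed u)).
  by have : orbit_conf a n (set_val u) by exact: set_valP.
move=> y; split.
- exact: short_exact_Gbraid.
- apply: short_exact_braid => // s; have [al [cal al0 al1]] := px s.
  exists (@conf_embed _ _ a n \o al); split.
  + apply: (cts_comp (f := al) (g := @conf_embed _ _ a n)) => //.
    exact: conf_embed_continuous.
  + by rewrite /= al0.
  + by rewrite /= al1 conf_embed_perm.
- split.
  + exact: pure_Gbraid_to_braidM.
  + exact: Gbraid_to_braidM.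
  + exact: Gbraid_to_braid_incl.
  + move=> c; have [s [al cE]] := Gbraid_rep c.
    (* The embedded path is a lift of the image loop, so both permutations are read off the same end
       point. *)
    by rewrite (Gbraid_to_braidE cE) (Gbraid_permE cE); exact: braid_permE.
- elim/pi1W => p.
  have [||g [cg pg]] := @homotopic_push_conf R m M M_manifold M_dim G n a p (@cts_fun _ _ p).
  + by rewrite path0; exact: inG.
  + by rewrite path1; exact: inG.
  have [e0 e1] := homotopic_ends pg.
  (* The homotopy fixes the ends and the embedding is injective, so the pushed path is again a loop
     at [x]. *)
  have g0 : g zero = x by apply: embed_inj; rewrite -[LHS]e0 path0.
  have g1 : g one = x by apply: embed_inj; rewrite -[LHS]e1 path1.
  have [c cE] := pure_Gbraid_of_loop x_free (mk_path cg g0 g1).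
  exists c; rewrite (pure_Gbraid_to_braidE cE).
  by apply/pi1_eqP; exact: homotopic_sym.
(* The push takes place in F(M, n), so the loop is first lifted, and the resulting homotopy is
   projected back to the quotient. *)
- move=> b; have [s [p ->]] := braid_rep hM b.
  have [||g [cg pg]] := @homotopic_push_conf R m M M_manifold M_dim G n a p (@cts_fun _ _ p).
  + by rewrite path0; exact: inG.
  + by rewrite path1 /y -conf_embed_perm; exact: inG.
  have [e0 e1] := homotopic_ends pg.
  have g0 : g zero = x by apply: embed_inj; rewrite -[LHS]e0 path0.
  have g1 : g one = orbit_conf_perm s x.
    by apply: embed_inj; rewrite -[LHS]e1 path1 conf_embed_perm.
  have [c cE] := Gbraid_of_path x_free (mk_path cg g0 g1).
  exists c; rewrite (Gbraid_to_braidE cE).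
  apply/pi1_eqP; apply: homotopic_sym.
  by apply: homotopic_comp pg; exact: conf_quot_continuous.
Qed.
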